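(* Let $a\neq b$ be real numbers, let $\alpha,\beta,\mu,\nu,p\in\mathbb{C}$ and $\lambda\in\mathbb{R}$ with $\Re(\alpha)>0$, $\Re(\beta)>0$, $\lambda\ge0$, put $$\chi(t)=b-a+\nu(t-a)+\mu(b-t),\qquad \xi(t)=\frac{(t-a)(b-t)}{\chi(t)^2},$$ and assume that $\chi(t)\neq0$ for all $t$ in the closed interval with endpoints $a$ and $b$; when $\lambda=0$ assume also that $|p\,\xi(t)|<1$ for all such $t$. Then $$\frac{1}{B(\alpha,\beta)}\int_a^b (t-a)^{\alpha-1}(b-t)^{\beta-1}\,\chi(t)^{-(\alpha+\beta)}\,E_\lambda[p\,\xi(t)]\,dt$$ $$=\frac{(\nu+1)^{-\alpha}(\mu+1)^{-\beta}}{b-a}\;{}_3\hat\Psi_2\left[\begin{array}{c}(\alpha,1),(\beta,1),(1,1);\\(\alpha+\beta,2),(1,\lambda);\end{array}\;\frac{p}{(\nu+1)(\mu+1)}\right].$$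
   Context: $B(x,y)=\Gamma(x)\Gamma(y)/\Gamma(x+y)$ is the beta function. The Mittag-Leffler function is $E_\lambda(z)=\sum_{n=0}^\infty \frac{z^n}{\Gamma(\lambda n+1)}$ for $\lambda\ge 0$; for $\lambda=0$ it is $E_0(z)=1/(1-z)$ with $|z|<1$. The normalized Wright hypergeometric function is $${}_p\hat\Psi_q\left[\begin{array}{c}(a_1,A_1),\ldots,(a_p,A_p);\\(b_1,B_1),\ldots,(b_q,B_q);\end{array}z\right]=\sum_{k=0}^\infty\frac{\prod_{j=1}^p\Gamma(a_j+A_jk)/\Gamma(a_j)}{\prod_{j=1}^q\Gamma(b_j+B_jk)/\Gamma(b_j)}\,\frac{z^k}{k!}$$ (a parameter pair $(1,0)$ contributes the factor $1$). Convention on powers: write $t=a+(b-a)s$ with $s\in[0,1]$, fix one value $L$ of $\log(b-a)$ (the real one if $a<b$) and one continuous branch $\ell(s)$ of $\log(1+\nu s+\mu(1-s))$ on $[0,1]$. Then, for $s\in(0,1)$, $(t-a)^{\alpha-1}=e^{(\alpha-1)L}s^{\alpha-1}$, $(b-t)^{\beta-1}=e^{(\beta-1)L}(1-s)^{\beta-1}$, $\chi(t)^{-(\alpha+\beta)}=e^{-(\alpha+\beta)(L+\ell(s))}$, $(\nu+1)^{-\alpha}=e^{-\alpha\ell(1)}$ and $(\mu+1)^{-\beta}=e^{-\beta\ell(0)}$. When $a<b$ and $1+\nu,1+\mu>0$ are real, all these are the ordinary powers of positive numbers. *)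

(* Defs.v *)
(* Stdlib reals with Coquelicot: [R], [C], improper Riemann integrals and
   series with values in [C]. *)
From Stdlib Require Import Reals ZArith List.
From Coquelicot Require Import Coquelicot.

Local Open Scope R_scope.
Local Open Scope C_scope.

Definition Cexp (z : C) : C :=
  RtoC (exp (Re z)) * (cos (Im z), sin (Im z)).

(* x^z with the real logarithm; meaningful only for x > 0. *)
Definition Rpowc (x : R) (z : C) : C := Cexp (z * RtoC (ln x)).

Definition ex_Cseries (u : nat -> C) : Prop :=
  @ex_series C_AbsRing C_NormedModule u.

(* Meaningful only when [ex_Cseries u]. *)
Definition Cseries (u : nat -> C) : C :=
  @iota C_CompleteNormedModule (@is_series C_AbsRing C_NormedModule u).

(* Convergent for 0 < Re z. *)
Definition euler_integral (z : C) : C :=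
  @RInt_gen C_R_CompleteNormedModule
    (fun u : R => Rpowc u (z - 1) * RtoC (exp (- u)))
    (at_right 0) (Rbar_locally p_infty).

Fixpoint rising (z : C) (n : nat) : C :=
  match n with
  | O => 1
  | S m => rising z m * (z + RtoC (INR m))
  end.

(* Euler's integral when 0 < Re z, where the shift n is 0, since [up r] is the
   integer in (r, r + 1]. Otherwise n is such that 0 < Re (z + n), and the
   formula is the continuation given by Gamma (z + 1) = z Gamma z. The value
   at the poles is 0, as [/ 0 = 0] in [C]. *)
Definition Gamma (z : C) : C :=
  let n := Z.to_nat (up (- Re z)) in
  euler_integral (z + RtoC (INR n)) / rising z n.

Definition Beta (x y : C) : C := Gamma x * Gamma y / Gamma (x + y).

Definition mittag_leffler_term (lambda : R) (z : C) (n : nat) : C :=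
  z ^ n / Gamma (RtoC (lambda * INR n + 1)).

(* For lambda = 0 this is the geometric series, of sum 1 / (1 - z) when
   |z| < 1. *)
Definition mittag_leffler (lambda : R) (z : C) : C :=
  Cseries (mittag_leffler_term lambda z).

Definition gamma_ratio_prod (l : list (C * R)) (k : nat) : C :=
  fold_right
    (fun aA r => Gamma (fst aA + RtoC (snd aA * INR k)) / Gamma (fst aA) * r)
    (RtoC 1) l.

Definition wright_hat_term (num den : list (C * R)) (z : C) (k : nat) : C :=
  gamma_ratio_prod num k / gamma_ratio_prod den k
  * (z ^ k / RtoC (INR (fact k))).

Definition wright_hat (num den : list (C * R)) (z : C) : C :=
  Cseries (wright_hat_term num den z).

(* x approached through the open interval with endpoints a and b, whatever
   their order. *)
Definition inside (a b x : R) : (R -> Prop) -> Prop :=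
  within (fun t => Rmin a b < t < Rmax a b)%R (locally x).

Definition ex_CRInt (f : R -> C) (a b : R) : Prop :=
  @ex_RInt_gen C_R_NormedModule f (inside a b a) (inside a b b).

(* The oriented integral from a to b, improper at both endpoints; it changes
   sign when a and b are exchanged. *)
Definition CRInt (f : R -> C) (a b : R) : C :=
  @RInt_gen C_R_CompleteNormedModule f (inside a b a) (inside a b b).

Definition chi (a b : R) (mu nu : C) (t : R) : C :=
  RtoC (b - a) + nu * RtoC (t - a) + mu * RtoC (b - t).

Definition xi (a b : R) (mu nu : C) (t : R) : C :=
  RtoC ((t - a) * (b - t)) / chi a b mu nu t ^ 2.

(* L is a value of log (b - a), the real one if a < b. *)
Definition log_length (a b : R) (L : C) : Prop :=
  Cexp L = RtoC (b - a) /\ ((a < b)%R -> L = RtoC (ln (b - a))).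

(* ell is a continuous branch on [0, 1] of log (1 + nu s + mu (1 - s)). *)
Definition log_branch (mu nu : C) (ell : R -> C) : Prop :=
  @continuous_on R_UniformSpace C_UniformSpace (fun s => 0 <= s <= 1)%R ell
  /\ forall s : R, (0 <= s <= 1)%R ->
       Cexp (ell s) = 1 + nu * RtoC s + mu * RtoC (1 - s).

(* (t - a)^(alpha-1) (b - t)^(beta-1) chi(t)^(-(alpha+beta)) at
   t = a + (b - a) s with 0 < s < 1, each power being taken with the logarithm
   L + ln s, L + ln (1 - s), L + ell s respectively. *)
Definition weight (a b : R) (alpha beta L : C) (ell : R -> C) (t : R) : C :=
  let s := ((t - a) / (b - a))%R in
  (Cexp ((alpha - 1) * L) * Rpowc s (alpha - 1))
  * (Cexp ((beta - 1) * L) * Rpowc (1 - s) (beta - 1))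
  * Cexp (- (alpha + beta) * (L + ell s)).

(* Main.v *)
Require Import Defs.
From Stdlib Require Import Reals ZArith List Lra Lia.
From Coquelicot Require Import Coquelicot.
Import ListNotations.
Local Open Scope R_scope.
Local Open Scope C_scope.

(** In the variable s = (t - a) / (b - a) one has chi(t) = (b - a) D(s) with
    D(s) = 1 + mu + (nu - mu) s, so xi(t) = s (1 - s) / D(s)^2, and the powers
    of b - a collected from the weight and from dt leave the factor
    1 / (b - a). Expanding the Mittag-Leffler function, the n-th term of the
    integral is a constant times the integral of the same weight with alpha
    and beta replaced by alpha + n and beta + n. The exchange of sum and
    integral is legitimate because the series is dominated, uniformly in s,
    by a convergent series of constants ([mittag_leffler_majorant]: for
    lambda > 0 the numbers Gamma(lambda n + 1) outgrow every geometric
    sequence, for lambda = 0 the argument has a maximum modulus below 1), and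
    because the weight is absolutely integrable ([is_Cint_series]).

    Two classical facts remain.

    The first is [beta_integral_along_segment]: the integral of
    s^(alpha-1) (1-s)^(beta-1) D(s)^(-(alpha+beta)) over (0, 1) is
    D(1)^(-alpha) D(0)^(-beta) B(alpha, beta). For D real this is the
    substitution u = D(1) s / D(s); for D complex that substitution leaves the
    real line and would call for a contour deformation. Instead, the segment
    from D(0) to D(1) is shrunk to the segment from D(0) to D(sigma), which
    the function s -> D(sigma s) parametrizes affinely and on which
    s -> ell(sigma s) is again a branch of the logarithm. Then
      F(sigma) = D(sigma)^alpha times the integral of
                 s^(alpha-1) (1-s)^(beta-1) D(sigma s)^(-(alpha+beta))
    is constant on [0, 1], since the sigma-derivative of its integrand is the
    s-derivative of
      (nu - mu) / D(sigma) * D(sigma)^alpha s^alpha (1-s)^beta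
      D(sigma s)^(-(alpha+beta)),
    which vanishes at s = 0 and s = 1. F(0) and F(1) give the two sides.

    The second is [beta_integral_euler]: B(alpha, beta) Gamma(alpha + beta) =
    Gamma(alpha) Gamma(beta). No double integral is used. Integration by parts
    gives beta B(alpha, beta) = (alpha + beta) B(alpha, beta + 1), from which
      B(alpha, beta) B(alpha + beta, 1 + n)
        = B(beta, 1 + n) B(alpha, beta + 1 + n)
    follows by induction on n. Multiplied by n^(alpha + beta), this tends to
    the relation by Gauss's limit n^alpha B(alpha, gamma + n) ->
    Gamma(alpha) ([gauss_limit]).

    Every improper integral is controlled by a real majorant with an
    elementary primitive. *)

(** * The complex exponential *)

Lemma C_ext (z w : C) : Re z = Re w -> Im z = Im w -> z = w.
Proof. destruct z, w; unfold Re, Im; simpl; intros -> ->; reflexivity. Qed.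

Lemma Cexp_plus (z w : C) : Cexp (z + w) = Cexp z * Cexp w.
Proof.
  destruct z as [x y], w as [u v]; unfold Cexp; simpl.
  rewrite exp_plus, cos_plus, sin_plus.
  apply C_ext; unfold Re, Im; simpl; ring.
Qed.

Lemma Cexp_RtoC (r : R) : Cexp (RtoC r) = RtoC (exp r).
Proof.
  unfold Cexp; simpl. rewrite cos_0, sin_0. apply C_ext; unfold Re, Im; simpl; ring.
Qed.

Lemma Cexp_0 : Cexp 0 = 1.
Proof. rewrite Cexp_RtoC, exp_0. reflexivity. Qed.

Lemma Cmod_Cexp (z : C) : Cmod (Cexp z) = exp (Re z).
Proof.
  unfold Cexp. rewrite Cmod_mult, Cmod_R.
  replace (Cmod (cos (Im z), sin (Im z))) with 1%R.
  - rewrite Rabs_pos_eq; [ring | left; apply exp_pos].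
  - unfold Cmod; simpl. rewrite <- sqrt_1 at 1. f_equal.
    pose proof (sin2_cos2 (Im z)) as H; unfold Rsqr, Im in *; lra.
Qed.

Lemma Cexp_neq_0 (z : C) : Cexp z <> 0.
Proof.
  intros H. pose proof (exp_pos (Re z)) as P.
  rewrite <- Cmod_Cexp, H, Cmod_0 in P. lra.
Qed.

Lemma Cexp_opp (z : C) : Cexp (- z) = / Cexp z.
Proof.
  assert (H : Cexp (- z) * Cexp z = 1).
  { rewrite <- Cexp_plus, <- Cexp_0. f_equal. ring. }
  rewrite <- (Cmult_1_r (Cexp (- z))), <- (Cinv_r (Cexp z)) by apply Cexp_neq_0.
  rewrite Cmult_assoc, H. ring.
Qed.

Lemma Cexp_mult_INR (z : C) (n : nat) : Cexp (RtoC (INR n) * z) = Cexp z ^ n.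
Proof.
  induction n as [|n IH].
  - simpl. rewrite <- Cexp_0. f_equal. ring.
  - rewrite S_INR, RtoC_plus. simpl. rewrite <- IH, <- Cexp_plus. f_equal. ring.
Qed.

(** * Limits, continuity and derivatives of functions from R to C *)

(** C occurs below both as a normed space over R, for derivatives and
    integrals, and over itself, for series. The uniform structure is in both
    cases the one of a product, so limits can be taken on real and imaginary
    parts. *)
Lemma norm_C_R (z : C) : @norm R_AbsRing C_R_NormedModule z = Cmod z.
Proof. symmetry; exact (Cmod_norm z). Qed.

Ltac unfold_ball := unfold ball; simpl; unfold AbsRing_ball, abs, minus, plus, opp; simpl.
Ltac unfold_ball_in H :=
  unfold ball in H; simpl in H; unfold AbsRing_ball, abs, minus, plus, opp in H; simpl in H.
Ltac unfold_balls :=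
  unfold ball in *; simpl in *; unfold AbsRing_ball, abs, minus, plus, opp in *; simpl in *.
Ltac ball_bounds H := unfold_ball_in H; apply Rabs_lt_between in H.

Lemma filterlim_C {T} (F : (T -> Prop) -> Prop) {FF : Filter F} (f : T -> C) (l : C) :
  filterlim (fun x => Re (f x)) F (locally (Re l)) ->
  filterlim (fun x => Im (f x)) F (locally (Im l)) ->
  filterlim f F (@locally C_UniformSpace l).
Proof.
  intros H1 H2. apply filterlim_locally. intros eps.
  generalize (proj1 (filterlim_locally _ _) H1 eps) (proj1 (filterlim_locally _ _) H2 eps).
  intros A B. generalize (filter_and _ _ A B). apply filter_imp.
  intros x [P Q]. split; assumption.
Qed.

Lemma filterlim_Re {T} (F : (T -> Prop) -> Prop) {FF : Filter F} (f : T -> C) (l : C) :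
  filterlim f F (@locally C_UniformSpace l) ->
  filterlim (fun x => Re (f x)) F (locally (Re l)).
Proof.
  intros H. apply filterlim_locally. intros eps.
  generalize (proj1 (filterlim_locally f l) H eps). apply filter_imp. intros x [P _]; exact P.
Qed.

Lemma filterlim_Im {T} (F : (T -> Prop) -> Prop) {FF : Filter F} (f : T -> C) (l : C) :
  filterlim f F (@locally C_UniformSpace l) ->
  filterlim (fun x => Im (f x)) F (locally (Im l)).
Proof.
  intros H. apply filterlim_locally. intros eps.
  generalize (proj1 (filterlim_locally f l) H eps). apply filter_imp. intros x [_ P]; exact P.
Qed.

Lemma filterlim_C_Cmod {T} (F : (T -> Prop) -> Prop) {FF : Filter F} (f : T -> C) (l : C) :
  filterlim f F (@locally C_UniformSpace l) <->
  (forall eps : posreal, F (fun x => (Cmod (f x - l) < eps)%R)).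
Proof.
  split.
  - intros H. pose proof (proj1 (@filterlim_locally_ball_norm R_AbsRing T C_R_NormedModule F FF f l) H) as A.
    intros eps. generalize (A eps). apply filter_imp. intros x.
    unfold ball_norm. rewrite norm_C_R. intro; exact H0.
  - intros H. apply (proj2 (@filterlim_locally_ball_norm R_AbsRing T C_R_NormedModule F FF f l)).
    intros eps. generalize (H eps). apply filter_imp. intros x.
    unfold ball_norm. rewrite norm_C_R. intro; exact H0.
Qed.

Notation ccont := (@continuous R_UniformSpace C_UniformSpace).
Notation cderive := (@is_derive R_AbsRing C_R_NormedModule).

Lemma continuous_C (f : R -> C) x :
  continuous (fun t => Re (f t)) x -> continuous (fun t => Im (f t)) x -> ccont f x.
Proof. intros; apply filterlim_C; auto; apply locally_filter. Qed.
Lemma continuous_Re (f : R -> C) x : ccont f x -> continuous (fun t => Re (f t)) x.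
Proof. intros; apply filterlim_Re; auto; apply locally_filter. Qed.
Lemma continuous_Im (f : R -> C) x : ccont f x -> continuous (fun t => Im (f t)) x.
Proof. intros; apply filterlim_Im; auto; apply locally_filter. Qed.

Lemma continuous_Cplus (f g : R -> C) x : ccont f x -> ccont g x -> ccont (fun t => f t + g t) x.
Proof. intros Hf Hg. apply (@continuous_plus R_UniformSpace R_AbsRing C_R_NormedModule f g x Hf Hg). Qed.

Lemma continuous_Cmult (f g : R -> C) x : ccont f x -> ccont g x -> ccont (fun t => f t * g t) x.
Proof.
  intros Hf Hg.
  pose proof (continuous_Re f x Hf). pose proof (continuous_Im f x Hf).
  pose proof (continuous_Re g x Hg). pose proof (continuous_Im g x Hg).
  apply continuous_C; simpl.
  - apply (continuous_minus (V := R_NormedModule) (fun t => Re (f t) * Re (g t))%R (fun t => Im (f t) * Im (g t))%R);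
    apply (continuous_mult (K := R_AbsRing)); auto.
  - apply (continuous_plus (V := R_NormedModule) (fun t => Re (f t) * Im (g t))%R (fun t => Im (f t) * Re (g t))%R);
    apply (continuous_mult (K := R_AbsRing)); auto.
Qed.

Lemma continuous_Cconst (c : C) x : ccont (fun _ => c) x.
Proof. apply continuous_const. Qed.

Lemma continuous_RtoC (f : R -> R) x : continuous f x -> ccont (fun t => RtoC (f t)) x.
Proof. intros H. apply continuous_C; simpl; [exact H | apply continuous_const]. Qed.

Lemma continuous_Copp (f : R -> C) x : ccont f x -> ccont (fun t => - f t) x.
Proof. intros Hf. apply (@continuous_opp R_UniformSpace R_AbsRing C_R_NormedModule f x Hf). Qed.

Lemma continuous_Cinv (f : R -> C) x : ccont f x -> f x <> 0 -> ccont (fun t => / f t) x.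
Proof.
  intros Hf Hx.
  pose proof (continuous_Re f x Hf) as A. pose proof (continuous_Im f x Hf) as B.
  assert (N : continuous (fun t => / (Re (f t) ^ 2 + Im (f t) ^ 2))%R x).
  { apply continuous_comp with (g := Rinv).
    - apply (continuous_plus (V := R_NormedModule) (fun t => Re (f t) ^ 2)%R (fun t => Im (f t) ^ 2)%R); simpl;
      repeat apply (continuous_mult (K := R_AbsRing)); auto; apply continuous_const.
    - apply continuous_Rinv. intros E. apply Hx. apply C_ext; simpl; nra. }
  apply continuous_C; simpl; unfold Rdiv; apply (continuous_mult (K := R_AbsRing)); auto.
  apply (continuous_opp (V := R_NormedModule)); auto.
Qed.

Lemma continuous_Cexp (f : R -> C) x : ccont f x -> ccont (fun t => Cexp (f t)) x.
Proof.
  intros Hf. apply continuous_Cmult.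
  - apply continuous_RtoC. apply continuous_comp; [apply continuous_Re; auto | apply continuous_exp].
  - apply continuous_C; simpl; apply continuous_comp;
    try (apply continuous_Im; auto); [apply continuous_cos | apply continuous_sin].
Qed.

Lemma continuous_Cmod (f : R -> C) x : ccont f x -> continuous (fun t => Cmod (f t)) x.
Proof.
  intros Hf. apply continuous_ext with (f := fun t => @norm R_AbsRing C_R_NormedModule (f t)).
  - intros t; apply norm_C_R.
  - apply continuous_comp with (g := @norm R_AbsRing C_R_NormedModule); [exact Hf|].
    apply filterlim_norm.
Qed.

Lemma continuous_Cpow (f : R -> C) n x : ccont f x -> ccont (fun t => f t ^ n) x.
Proof.
  intros Hf; induction n as [|n IH]; simpl; [apply continuous_Cconst | apply continuous_Cmult; auto].
Qed.

Lemma is_derive_C (f : R -> C) x l :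
  is_derive (fun t => Re (f t)) x (Re l) -> is_derive (fun t => Im (f t)) x (Im l) -> cderive f x l.
Proof.
  intros H1 H2. unfold is_derive in *.
  apply filterdiff_ext with (f := fun t => (Re (f t), Im (f t))).
  { intros t. destruct (f t); reflexivity. }
  apply filterdiff_ext_lin with (l1 := fun y => (scal y (Re l), scal y (Im l))).
  2:{ intros y. destruct l; reflexivity. }
  apply (@filterdiff_comp'_2 R_AbsRing R_NormedModule R_NormedModule R_NormedModule C_R_NormedModule
    (fun t => Re (f t)) (fun t => Im (f t)) (fun u v => (u, v)) x _ _ (fun u v => (u, v)) H1 H2).
  apply filterdiff_ext with (f := fun t : R * R => t); [intros [u v]; reflexivity|].
  apply filterdiff_ext_lin with (l1 := fun t : R * R => t); [|intros [u v]; reflexivity].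
  apply filterdiff_id.
Qed.

Lemma is_derive_Re (f : R -> C) x l : cderive f x l -> is_derive (fun t => Re (f t)) x (Re l).
Proof.
  intros H. unfold is_derive in *.
  apply (@filterdiff_comp' R_AbsRing R_NormedModule C_R_NormedModule R_NormedModule f
     (fun z : C => Re z) x _ (fun z : C => Re z) H).
  apply filterdiff_linear, (@is_linear_fst R_AbsRing R_NormedModule R_NormedModule).
Qed.
Lemma is_derive_Im (f : R -> C) x l : cderive f x l -> is_derive (fun t => Im (f t)) x (Im l).
Proof.
  intros H. unfold is_derive in *.
  apply (@filterdiff_comp' R_AbsRing R_NormedModule C_R_NormedModule R_NormedModule f
     (fun z : C => Im z) x _ (fun z : C => Im z) H).
  apply filterdiff_linear, (@is_linear_snd R_AbsRing R_NormedModule R_NormedModule).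
Qed.

Lemma is_derive_Cmult (f g : R -> C) x (df dg : C) :
  cderive f x df -> cderive g x dg -> cderive (fun t => f t * g t) x (df * g x + f x * dg).
Proof.
  intros Hf Hg.
  pose proof (is_derive_Re _ _ _ Hf). pose proof (is_derive_Im _ _ _ Hf).
  pose proof (is_derive_Re _ _ _ Hg). pose proof (is_derive_Im _ _ _ Hg).
  apply is_derive_C; simpl.
  - evar_last.
    + apply (is_derive_minus (V := R_NormedModule) (fun t => Re (f t) * Re (g t))%R (fun t => Im (f t) * Im (g t))%R);
      apply Derive.is_derive_mult; eassumption.
    + unfold minus, plus, opp, Re, Im; simpl; ring.
  - evar_last.
    + apply (is_derive_plus (V := R_NormedModule) (fun t => Re (f t) * Im (g t))%R (fun t => Im (f t) * Re (g t))%R);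
      apply Derive.is_derive_mult; eassumption.
    + unfold plus, Re, Im; simpl; ring.
Qed.

Lemma is_derive_Cplus (f g : R -> C) x (df dg : C) :
  cderive f x df -> cderive g x dg -> cderive (fun t => f t + g t) x (df + dg).
Proof. intros Hf Hg. exact (is_derive_plus (V := C_R_NormedModule) f g x df dg Hf Hg). Qed.

Lemma is_derive_Cconst (c : C) x : cderive (fun _ => c) x (RtoC 0).
Proof. exact (@is_derive_const R_AbsRing C_R_NormedModule c x). Qed.

Lemma is_derive_Cscal (f : R -> C) x (df c : C) :
  cderive f x df -> cderive (fun t => c * f t) x (c * df).
Proof.
  intros H. replace (c * df) with (0 * f x + c * df) by ring.
  apply is_derive_Cmult; [apply is_derive_Cconst | exact H].
Qed.

Lemma is_derive_RtoC (f : R -> R) x df :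
  is_derive f x df -> cderive (fun t => RtoC (f t)) x (RtoC df).
Proof. intros H. apply is_derive_C; simpl; [exact H | apply (is_derive_const (V := R_NormedModule))]. Qed.

Lemma is_derive_Cexp (f : R -> C) x (df : C) :
  cderive f x df -> cderive (fun t => Cexp (f t)) x (df * Cexp (f x)).
Proof.
  intros H. pose proof (is_derive_Re _ _ _ H) as A. pose proof (is_derive_Im _ _ _ H) as B.
  apply is_derive_C; unfold Cexp; simpl.
  - apply is_derive_ext with (f := fun t => (exp (Re (f t)) * cos (Im (f t)))%R); [intros; simpl; ring|].
    evar_last.
    + apply Derive.is_derive_mult; 
      [apply (is_derive_comp exp) | apply (is_derive_comp cos)]; try eassumption;
      [apply is_derive_exp | apply is_derive_cos].
    + unfold scal; simpl; unfold mult, Re, Im; simpl; ring.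
  - apply is_derive_ext with (f := fun t => (exp (Re (f t)) * sin (Im (f t)))%R); [intros; simpl; ring|].
    evar_last.
    + apply Derive.is_derive_mult; 
      [apply (is_derive_comp exp) | apply (is_derive_comp sin)]; try eassumption;
      [apply is_derive_exp | apply is_derive_sin].
    + unfold scal; simpl; unfold mult, Re, Im; simpl; ring.
Qed.

(** * Improper integrals over an interval *)

(** An open interval P together with the filters of the neighbourhoods of its
    two ends, so that (0, 1) and the half-line (0, oo) are treated alike. *)
Record interval_ends (P : R -> Prop) (Fa Fb : (R -> Prop) -> Prop) : Prop := {
  ends_left : ProperFilter Fa;
  ends_right : ProperFilter Fb;
  ends_convex : forall x y z : R, P x -> P y -> (x <= z <= y)%R -> P z;
  ends_near_left : forall x, P x -> Fa (fun u => P u /\ (u <= x)%R);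
  ends_near_right : forall x, P x -> Fb (fun v => P v /\ (x <= v)%R);
  ends_open : forall x, P x -> locally x P;
  ends_inhabited : exists x, P x
}.

Notation is_Cint := (@is_RInt_gen C_R_NormedModule).

Lemma ends_mid P Fa Fb (E : interval_ends P Fa Fb) x y z :
  P x -> P y -> (Rmin x y <= z <= Rmax x y)%R -> P z.
Proof.
  intros Px Py. unfold Rmin, Rmax. destruct (Rle_dec x y); intros Hz.
  - apply (ends_convex _ _ _ E x y); auto.
  - apply (ends_convex _ _ _ E y x); auto.
Qed.

Lemma ends_prod P Fa Fb (E : interval_ends P Fa Fb) :
  filter_prod Fa Fb (fun uv => P (fst uv) /\ P (snd uv) /\ (fst uv <= snd uv)%R).
Proof.
  destruct (ends_inhabited _ _ _ E) as [x Px].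
  apply (Filter_prod _ _ _ _ _ (ends_near_left _ _ _ E x Px) (ends_near_right _ _ _ E x Px)).
  intros u v [Pu Hu] [Pv Hv]; simpl; repeat split; auto; lra.
Qed.

Lemma ex_RInt_interval {V : CompleteNormedModule R_AbsRing} P Fa Fb
  (E : interval_ends P Fa Fb) (f : R -> V) x y :
  (forall t, P t -> continuous f t) -> P x -> P y -> ex_RInt f x y.
Proof.
  intros Hf Px Py. apply (ex_RInt_continuous (V := V)). intros z Hz.
  apply Hf, (ends_mid P Fa Fb E x y); auto.
Qed.

(** Replaces the relational limit in the definition of the improper integral
    by an ordinary limit, to which Cauchy's criterion and the comparison of
    limits apply. *)
Lemma is_RInt_gen_filterlim {V : CompleteNormedModule R_AbsRing} Fa Fb
  {FFa : Filter Fa} {FFb : Filter Fb} (f : R -> V) l :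
  filter_prod Fa Fb (fun uv => ex_RInt f (fst uv) (snd uv)) ->
  (is_RInt_gen f Fa Fb l <->
   filterlim (fun uv => RInt f (fst uv) (snd uv)) (filter_prod Fa Fb) (locally l)).
Proof.
  intros Hex. split; intros H Q HQ.
  - generalize (H Q HQ). unfold filtermapi, filtermap. apply filter_imp.
    intros uv [y [Hy Qy]]. rewrite (is_RInt_unique _ _ _ _ Hy). exact Qy.
  - pose proof (H Q HQ) as K. unfold filtermap in K.
    generalize (filter_and _ _ Hex K). unfold filtermapi. apply filter_imp.
    intros uv [He Qy]. exists (RInt f (fst uv) (snd uv)). split; [|exact Qy].
    apply (RInt_correct (V := V)); exact He.
Qed.

Lemma is_RInt_gen_inside {V : CompleteNormedModule R_AbsRing} P Fa Fb
  (E : interval_ends P Fa Fb) (f : R -> V) l :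
  (forall t, P t -> continuous f t) ->
  (is_RInt_gen f Fa Fb l <->
   filterlim (fun uv => RInt f (fst uv) (snd uv)) (filter_prod Fa Fb) (locally l)).
Proof.
  intros Hf. pose proof (ends_left _ _ _ E). pose proof (ends_right _ _ _ E).
  apply (is_RInt_gen_filterlim Fa Fb f l).
  refine (filter_imp _ _ _ (ends_prod P Fa Fb E)). intros uv [Pu [Pv _]].
  apply (ex_RInt_interval P Fa Fb E); auto.
Qed.

Lemma RInt_le_is_RInt_gen P Fa Fb (E : interval_ends P Fa Fb) (g : R -> R) (l x y : R) :
  (forall t, P t -> continuous g t) -> (forall t, P t -> (0 <= g t)%R) ->
  is_RInt_gen g Fa Fb l -> P x -> P y -> (x <= y)%R -> (RInt g x y <= l)%R.
Proof.
  intros Hc Hp Hg Px Py Hxy.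
  pose proof (ends_left _ _ _ E). pose proof (ends_right _ _ _ E).
  apply (is_RInt_gen_inside (V := R_CompleteNormedModule) P Fa Fb E g l Hc) in Hg.
  apply (filterlim_le (F := filter_prod Fa Fb) (fun _ => RInt g x y) (fun uv => RInt g (fst uv) (snd uv))
    (Finite (RInt g x y)) (Finite l)).
  - apply (Filter_prod _ _ _ _ _ (ends_near_left _ _ _ E x Px) (ends_near_right _ _ _ E y Py)).
    intros u v [Pu Hu] [Pv Hv]; simpl.
    assert (X : forall s t, P s -> P t -> ex_RInt g s t)
      by (intros; apply (ex_RInt_interval (V := R_CompleteNormedModule) P Fa Fb E); auto).
    assert (Q : forall s t, P s -> P t -> (s <= t)%R -> (0 <= RInt g s t)%R).
    { intros s t Ps Pt Hst. apply RInt_ge_0; auto. intros z Hz.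
      apply Hp, (ends_convex _ _ _ E s t); auto; lra. }
    rewrite <- (RInt_Chasles (V := R_CompleteNormedModule) g u x v); auto.
    rewrite <- (RInt_Chasles (V := R_CompleteNormedModule) g x y v); auto.
    unfold plus; simpl. pose proof (Q u x Pu Px Hu). pose proof (Q y v Py Pv Hv). lra.
  - apply filterlim_const.
  - exact Hg.
Qed.

Lemma Cmod_RInt_le P Fa Fb (E : interval_ends P Fa Fb) (f : R -> C) (g : R -> R) (x y : R) :
  (forall t, P t -> ccont f t) -> (forall t, P t -> continuous g t) ->
  (forall t, P t -> (Cmod (f t) <= g t)%R) -> P x -> P y ->
  (Cmod (@RInt C_R_CompleteNormedModule f x y) <= Rabs (RInt g x y))%R.
Proof.
  intros Cf Cg Hfg.
  assert (K : forall x y, P x -> P y -> (x <= y)%R ->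
    (Cmod (@RInt C_R_CompleteNormedModule f x y) <= Rabs (RInt g x y))%R).
  { clear x y. intros x y Px Py Hxy. eapply Rle_trans; [|apply Rle_abs].
    rewrite <- norm_C_R.
    apply (norm_RInt_le (V := C_R_NormedModule) f g x y); auto.
    - intros z Hz. rewrite norm_C_R. apply Hfg, (ends_convex _ _ _ E x y); auto.
    - apply (RInt_correct (V := C_R_CompleteNormedModule)), (ex_RInt_interval P Fa Fb E); auto.
    - apply (RInt_correct (V := R_CompleteNormedModule)), (ex_RInt_interval (V := R_CompleteNormedModule) P Fa Fb E); auto. }
  intros Px Py. destruct (Rle_dec x y) as [H|H]; [apply K; auto|].
  rewrite <- (opp_RInt_swap (V := C_R_CompleteNormedModule)), <- (opp_RInt_swap (V := R_CompleteNormedModule)).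
  - change (Cmod (- @RInt C_R_CompleteNormedModule f y x) <= Rabs (- RInt g y x))%R.
    rewrite Cmod_opp, Rabs_Ropp. apply K; auto; lra.
  - apply (ex_RInt_interval (V := R_CompleteNormedModule) P Fa Fb E); auto.
  - apply (ex_RInt_interval (V := C_R_CompleteNormedModule) P Fa Fb E); auto.
Qed.

Lemma Cmod_is_Cint_le P Fa Fb (E : interval_ends P Fa Fb) (f : R -> C) (g : R -> R) (lf : C) (lg : R) :
  (forall t, P t -> (Cmod (f t) <= g t)%R) ->
  is_Cint f Fa Fb lf -> is_RInt_gen g Fa Fb lg -> (Cmod lf <= lg)%R.
Proof.
  intros Hfg If Ig. rewrite <- norm_C_R.
  pose proof (ends_left _ _ _ E). pose proof (ends_right _ _ _ E).
  apply (RInt_gen_norm (V := C_R_CompleteNormedModule) (Fa := Fa) (Fb := Fb) f g); auto;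
  refine (filter_imp _ _ _ (ends_prod P Fa Fb E)); intros [u v]; simpl; intros [Pu [Pv Huv]]; auto.
  intros x Hx. rewrite norm_C_R. apply Hfg, (ends_convex _ _ _ E u v); auto.
Qed.

(** Cauchy's criterion: two integrals of f over large subintervals differ by
    two end pieces, each bounded by the corresponding piece for g. *)
Lemma is_Cint_dominated P Fa Fb (E : interval_ends P Fa Fb) (f : R -> C) (g : R -> R) (lg : R) :
  (forall t, P t -> ccont f t) -> (forall t, P t -> continuous g t) ->
  (forall t, P t -> (Cmod (f t) <= g t)%R) -> is_RInt_gen g Fa Fb lg ->
  exists lf, is_Cint f Fa Fb lf.
Proof.
  intros Cf Cg Hfg Ig.
  pose proof (ends_left _ _ _ E) as FA. pose proof (ends_right _ _ _ E) as FB.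
  apply (is_RInt_gen_inside (V := R_CompleteNormedModule) P Fa Fb E g lg Cg) in Ig.
  cut (exists l : C, filterlim (fun uv => @RInt C_R_CompleteNormedModule f (fst uv) (snd uv))
         (filter_prod Fa Fb) (@locally C_UniformSpace l)).
  { intros [l Hl]. exists l. apply (is_RInt_gen_inside (V := C_R_CompleteNormedModule) P Fa Fb E); auto. }
  pose proof (proj2 (filterlim_locally_cauchy (U := R_CompleteNormedModule) _) (ex_intro _ lg Ig)) as CG.
  apply (filterlim_locally_cauchy (U := C_R_CompleteNormedModule)). intros eps.
  destruct (CG (pos_div_2 eps)) as [S [HS HC]].
  destruct (filter_and _ _ HS (ends_prod _ _ _ E)) as [Q T HQ HT HQT].
  exists (fun uv => Q (fst uv) /\ T (snd uv)). split.
  { apply (Filter_prod _ _ _ Q T); auto. }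
  intros [u v] [u' v'] [Qu Tv] [Qu' Tv']; simpl in *.
  destruct (HQT u v Qu Tv) as [S1 [P1 [P2 _]]]. destruct (HQT u' v' Qu' Tv') as [S2 [P3 [P4 _]]].
  destruct (HQT u' v Qu' Tv) as [S3 _]. simpl in *.
  pose proof (HC (u', v) (u, v) S3 S1) as B1. pose proof (HC (u', v) (u', v') S3 S2) as B2.
  simpl in B1, B2.
  assert (X : forall s t, P s -> P t -> ex_RInt g s t)
    by (intros; apply (ex_RInt_interval (V := R_CompleteNormedModule) P Fa Fb E); auto).
  assert (Y : forall s t, P s -> P t -> @ex_RInt C_R_NormedModule f s t)
    by (intros; apply (ex_RInt_interval (V := C_R_CompleteNormedModule) P Fa Fb E); auto).
  rewrite <- (RInt_Chasles (V := R_CompleteNormedModule) g u u' v) in B1; auto.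
  rewrite <- (RInt_Chasles (V := R_CompleteNormedModule) g u' v v') in B2; auto.
  assert (B1' : (Rabs (RInt g u u') < eps / 2)%R).
  { unfold_ball_in B1.
    match type of B1 with (Rabs ?a < _)%R => replace (RInt g u u') with a; [exact B1|] end. ring. }
  assert (B2' : (Rabs (RInt g v v') < eps / 2)%R).
  { unfold_ball_in B2.
    match type of B2 with (Rabs ?a < _)%R => replace (RInt g v v') with a; [exact B2|] end. ring. }
  apply (@norm_compat1 R_AbsRing C_R_NormedModule).
  rewrite norm_C_R.
  rewrite <- (RInt_Chasles (V := C_R_CompleteNormedModule) f u u' v); auto.
  rewrite <- (RInt_Chasles (V := C_R_CompleteNormedModule) f u' v v'); auto.
  pose proof (Cmod_RInt_le P Fa Fb E f g u u' Cf Cg Hfg P1 P3) as D1.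
  pose proof (Cmod_RInt_le P Fa Fb E f g v v' Cf Cg Hfg P2 P4) as D2.
  set (A := @RInt C_R_CompleteNormedModule f u u') in *.
  set (B := @RInt C_R_CompleteNormedModule f v v') in *.
  set (D := @RInt C_R_CompleteNormedModule f u' v) in *.
  replace (@minus C_R_NormedModule (plus D B) (plus A D)) with (B + - A : C).
  - pose proof (Cmod_triangle B (- A)) as TR. rewrite Cmod_opp in TR. lra.
  - unfold minus. change (B + - A = (D + B) + - (A + D) :> C). ring.
Qed.

Lemma is_RInt_gen_primitive {V : CompleteNormedModule R_AbsRing} P Fa Fb
  (E : interval_ends P Fa Fb) (h dh : R -> V) la lb :
  (forall t, P t -> is_derive h t (dh t)) -> (forall t, P t -> continuous dh t) ->
  filterlim h Fa (locally la) -> filterlim h Fb (locally lb) ->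
  is_RInt_gen dh Fa Fb (minus lb la).
Proof.
  intros Hd Hc Ha Hb.
  pose proof (ends_left _ _ _ E) as FA. pose proof (ends_right _ _ _ E) as FB.
  apply (is_RInt_gen_inside P Fa Fb E); auto.
  apply filterlim_ext_loc with (f := fun uv => minus (h (snd uv)) (h (fst uv))).
  - refine (filter_imp _ _ _ (ends_prod P Fa Fb E)). intros [u v]; simpl; intros [Pu [Pv _]].
    symmetry. apply is_RInt_unique, is_RInt_derive; intros x Hx; [apply Hd | apply Hc];
    apply (ends_mid P Fa Fb E u v); auto.
  - unfold minus. apply (filterlim_comp_2 (G := locally lb) (H := locally (opp la))).
    + apply (filterlim_comp _ _ _ snd h _ Fb); [apply filterlim_snd | exact Hb].
    + eapply filterlim_comp; [|apply (filterlim_opp (V := V))].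
      apply (filterlim_comp _ _ _ fst h _ Fa); [apply filterlim_fst | exact Ha].
    + apply (filterlim_plus (V := V)).
Qed.

(** The convexity of P is expressed through [Rmin] and [Rmax] because the end
    of Fa may lie to the right of the end of Fb: the substitution reverses the
    orientation when a > b in the theorem. *)
Lemma is_RInt_gen_subst {V : CompleteNormedModule R_AbsRing} (P : R -> Prop) Fa Fb
  {FFa : Filter Fa} {FFb : Filter Fb} Ga Gb
  (f : R -> V) (phi dphi : R -> R) l :
  (forall x y z, P x -> P y -> (Rmin x y <= z <= Rmax x y)%R -> P z) ->
  Fa P -> Fb P ->
  (forall t, P t -> continuous f (phi t)) ->
  (forall t, P t -> is_derive phi t (dphi t)) -> (forall t, P t -> continuous dphi t) ->
  filterlim phi Fa Ga -> filterlim phi Fb Gb ->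
  is_RInt_gen f Ga Gb l ->
  is_RInt_gen (fun t => scal (dphi t) (f (phi t))) Fa Fb l.
Proof.
  intros Hconv PA PB Hf Hphi Hdphi Ha Hb Hl Q HQ.
  destruct (Hl Q HQ) as [S T HS HT HST].
  apply (Filter_prod _ _ _ (fun u => P u /\ S (phi u)) (fun v => P v /\ T (phi v))).
  - apply filter_and; [exact PA | exact (Ha _ HS)].
  - apply filter_and; [exact PB | exact (Hb _ HT)].
  - intros u v [Pu Su] [Pv Tv]. destruct (HST _ _ Su Tv) as [y [Hy Qy]].
    exists y. split; [|exact Qy]. simpl in *.
    rewrite <- (is_RInt_unique _ _ _ _ Hy).
    apply is_RInt_comp; intros x Hx; [apply Hf | split; [apply Hphi | apply Hdphi]];
    apply (Hconv u v); auto.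
Qed.

Lemma is_Cint_plus Fa Fb {FFa : Filter Fa} {FFb : Filter Fb} (f g : R -> C) (lf lg : C) :
  is_Cint f Fa Fb lf -> is_Cint g Fa Fb lg -> is_Cint (fun t => f t + g t) Fa Fb (lf + lg).
Proof. exact (is_RInt_gen_plus (V := C_R_NormedModule) f g lf lg). Qed.

Lemma is_RInt_Cmult (c : C) (f : R -> C) x y (l : C) :
  @is_RInt C_R_NormedModule f x y l -> @is_RInt C_R_NormedModule (fun t => c * f t) x y (c * l).
Proof.
  intros H.
  pose proof (is_RInt_fct_extend_fst (U := R_NormedModule) (V := R_NormedModule) f x y l H) as A.
  pose proof (is_RInt_fct_extend_snd (U := R_NormedModule) (V := R_NormedModule) f x y l H) as B.
  apply (is_RInt_fct_extend_pair (U := R_NormedModule) (V := R_NormedModule) (fun t => c * f t)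
    x y (fst c * fst l - snd c * snd l)%R (fst c * snd l + snd c * fst l)%R).
  - apply (is_RInt_minus (V := R_NormedModule) (fun t => fst c * fst (f t))%R (fun t => snd c * snd (f t))%R
      x y (fst c * fst l)%R (snd c * snd l)%R); apply (is_RInt_scal (V := R_NormedModule)); assumption.
  - apply (is_RInt_plus (V := R_NormedModule) (fun t => fst c * snd (f t))%R (fun t => snd c * fst (f t))%R
      x y (fst c * snd l)%R (snd c * fst l)%R); apply (is_RInt_scal (V := R_NormedModule)); assumption.
Qed.

Lemma is_Cint_scal Fa Fb {FFa : Filter Fa} {FFb : Filter Fb} (c : C) (f : R -> C) (l : C) :
  is_Cint f Fa Fb l -> is_Cint (fun t => c * f t) Fa Fb (c * l).
Proof.
  intros H Q HQ.
  assert (K : filterlim (fun z : C => c * z) (@locally C_UniformSpace l) (@locally C_UniformSpace (c * l))).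
  { exact (@filterlim_scal_r C_AbsRing C_NormedModule c l). }
  generalize (H _ (K Q HQ)). unfold filtermapi, filtermap. apply filter_imp.
  intros uv [y [Hy Qy]]. exists (c * y). split; [apply is_RInt_Cmult; exact Hy | exact Qy].
Qed.

Lemma is_Cint_minus Fa Fb {FFa : Filter Fa} {FFb : Filter Fb} (f g : R -> C) (lf lg : C) :
  is_Cint f Fa Fb lf -> is_Cint g Fa Fb lg -> is_Cint (fun t => f t - g t) Fa Fb (lf - lg).
Proof. exact (is_RInt_gen_minus (V := C_R_NormedModule) f g lf lg). Qed.

Lemma is_Cint_unique P Fa Fb (E : interval_ends P Fa Fb) (f g : R -> C) (l m : C) :
  (forall t, P t -> f t = g t) -> is_Cint f Fa Fb l -> is_Cint g Fa Fb m -> l = m.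
Proof.
  intros Hfg Hf Hg.
  pose proof (ends_left _ _ _ E) as FA. pose proof (ends_right _ _ _ E) as FB.
  assert (PA : ProperFilter' Fa) by (apply Proper_StrongProper; assumption).
  assert (PB : ProperFilter' Fb) by (apply Proper_StrongProper; assumption).
  assert (Hf' : is_Cint g Fa Fb l).
  { refine (is_RInt_gen_ext (V := C_R_NormedModule) f g l _ Hf).
    refine (filter_imp _ _ _ (ends_prod P Fa Fb E)). intros [u v] [Pu [Pv _]] x Hx.
    apply Hfg, (ends_mid P Fa Fb E u v); auto; simpl in *; lra. }
  rewrite <- (is_RInt_gen_unique (V := C_R_CompleteNormedModule) g l Hf').
  apply (is_RInt_gen_unique (V := C_R_CompleteNormedModule) g m Hg).
Qed.

Lemma is_Cint_ext P Fa Fb (E : interval_ends P Fa Fb) (f g : R -> C) (l : C) :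
  (forall t, P t -> f t = g t) -> is_Cint f Fa Fb l -> is_Cint g Fa Fb l.
Proof.
  intros Hfg Hf.
  pose proof (ends_left _ _ _ E) as FA. pose proof (ends_right _ _ _ E) as FB.
  refine (is_RInt_gen_ext (V := C_R_NormedModule) f g l _ Hf).
  refine (filter_imp _ _ _ (ends_prod P Fa Fb E)). intros [u v] [Pu [Pv _]] x Hx.
  apply Hfg, (ends_mid P Fa Fb E u v); auto; simpl in *; lra.
Qed.

Lemma ends_unit : interval_ends (fun s => (0 < s < 1)%R) (at_right 0) (at_left 1).
Proof.
  constructor.
  - apply at_right_proper_filter.
  - apply at_left_proper_filter.
  - intros; lra.
  - intros x Hx. assert (Hx' : (0 < x)%R) by lra. exists (mkposreal x Hx'). intros y By Hy.
    ball_bounds By. lra.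
  - intros x Hx. assert (Hx' : (0 < 1 - x)%R) by lra. exists (mkposreal _ Hx'). intros y By Hy.
    ball_bounds By. lra.
  - intros x Hx. apply (locally_interval _ x 0 1); simpl; try lra. intros; lra.
  - exists (/2)%R; lra.
Qed.

Lemma ends_half_line : interval_ends (fun s => (0 < s)%R) (at_right 0) (Rbar_locally p_infty).
Proof.
  constructor.
  - apply at_right_proper_filter.
  - apply Rbar_locally_filter.
  - intros; lra.
  - intros x Hx. exists (mkposreal x Hx). intros y By Hy.
    ball_bounds By. lra.
  - intros x Hx. exists x. intros y Hy. lra.
  - intros x Hx. apply (locally_interval _ x 0 p_infty); simpl; auto.
  - exists 1%R; lra.
Qed.

(** * Termwise integration of a dominated series *)

Lemma Cmod_series_tail_le (e : nat -> C) (s : C) (M : nat -> R) (m : R) (N : nat) :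
  (forall n, (Cmod (e n) <= M n)%R) -> @is_series C_AbsRing C_NormedModule e s ->
  is_series M m -> (Cmod (s - @sum_n C_AbelianMonoid e N) <= m - sum_n M N)%R.
Proof.
  intros He Hs Hm.
  assert (M0 : forall n, (0 <= M n)%R) by (intros n; eapply Rle_trans; [apply Cmod_ge_0 | apply He]).
  assert (Inc : forall n, (sum_n M n <= m)%R).
  { intros n. apply (is_lim_seq_incr_compare (sum_n M) m); [exact Hm|].
    intros k. rewrite sum_Sn. unfold plus; simpl. pose proof (M0 (S k)). lra. }
  assert (D : forall k, (Cmod (@sum_n C_AbelianMonoid e (k + N) - @sum_n C_AbelianMonoid e N) <= sum_n M (k + N) - sum_n M N)%R).
  { induction k as [|k IH]; simpl.
    - replace (_ - _) with (RtoC 0) by ring. rewrite Cmod_0. lra.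
    - rewrite !sum_Sn.
      change (@plus C_AbelianMonoid) with Cplus. change (@plus R_AbelianMonoid) with Rplus.
      replace (_ + _ - _) with ((@sum_n C_AbelianMonoid e (k + N) - @sum_n C_AbelianMonoid e N) + e (S (k + N))) by ring.
      eapply Rle_trans; [apply Cmod_triangle|]. pose proof (He (S (k + N))). lra. }
  apply le_epsilon. intros eps Heps.
  destruct (proj1 (filterlim_C_Cmod eventually (@sum_n C_AbelianMonoid e) s) Hs (mkposreal eps Heps)) as [K HK].
  pose proof (HK (K + N)%nat ltac:(lia)) as A. simpl in A.
  pose proof (D K) as B. pose proof (Inc (K + N)%nat) as Q.
  set (x := @sum_n C_AbelianMonoid e (K + N)) in *. set (y := @sum_n C_AbelianMonoid e N) in *.
  replace (s - y) with ((x - y) + - (x - s)) by ring.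
  eapply Rle_trans; [apply Cmod_triangle|]. rewrite Cmod_opp. lra.
Qed.

Lemma is_lim_series_tail (M : nat -> R) (m c : R) :
  is_series M m -> is_lim_seq (fun N => (m - sum_n M N) * c)%R 0.
Proof.
  intros Hm. replace (Finite 0) with (Finite ((m - m) * c)) by (f_equal; ring).
  apply is_lim_seq_mult'; [|apply is_lim_seq_const].
  apply is_lim_seq_minus'; [apply is_lim_seq_const | exact Hm].
Qed.

Lemma continuous_sum_n (e : nat -> R -> C) (t : R) (N : nat) :
  (forall n, ccont (e n) t) -> ccont (fun x => @sum_n C_AbelianMonoid (fun n => e n x) N) t.
Proof.
  intros H. induction N as [|N IH].
  - apply continuous_ext with (f := e O); [intros; rewrite sum_O; reflexivity | apply H].
  - apply continuous_ext with (f := fun x => @sum_n C_AbelianMonoid (fun n => e n x) N + e (S N) x).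
    + intros; rewrite sum_Sn; reflexivity.
    + apply continuous_Cplus; auto.
Qed.

Lemma continuous_series (P : R -> Prop) (e : nat -> R -> C) (s : R -> C) (M : nat -> R) (t : R) :
  locally t P -> (forall n, ccont (e n) t) ->
  (forall n x, P x -> (Cmod (e n x) <= M n)%R) -> ex_series M ->
  (forall x, P x -> @is_series C_AbsRing C_NormedModule (fun n => e n x) (s x)) ->
  ccont s t.
Proof.
  intros Pt Ce HM [m Hm] Hs.
  apply (filterlim_C_Cmod (locally t)). intros eps.
  assert (e3 : (0 < eps / 3)%R) by (pose proof (cond_pos eps); lra).
  pose proof (is_lim_series_tail M m 1 Hm) as L.
  destruct (proj1 (filterlim_locally _ _) L (mkposreal _ e3)) as [N HN].
  pose proof (HN N (le_n N)) as T. clear HN L.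
  ball_bounds T.
  pose proof (continuous_sum_n e t N Ce) as CN.
  pose proof (proj1 (filterlim_C_Cmod (locally t) _ _) CN (mkposreal _ e3)) as D.
  pose proof (locally_singleton _ _ Pt) as Ptt.
  refine (filter_imp _ _ _ (filter_and _ _ Pt D)). simpl. intros x [Px Dx].
  pose proof (Cmod_series_tail_le _ _ M m N (fun n => HM n x Px) (Hs x Px) Hm) as A.
  pose proof (Cmod_series_tail_le _ _ M m N (fun n => HM n t Ptt) (Hs t Ptt) Hm) as B.
  set (u := @sum_n C_AbelianMonoid (fun n => e n x) N) in *.
  set (v := @sum_n C_AbelianMonoid (fun n => e n t) N) in *.
  replace (s x - s t) with ((s x - u) + ((u - v) + - (s t - v))) by ring.
  eapply Rle_lt_trans; [apply Cmod_triangle|].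
  eapply Rle_lt_trans; [apply Rplus_le_compat_l, Cmod_triangle|]. rewrite Cmod_opp. lra.
Qed.

(** Past the index N the remainder of the integrand is at most
    (m - M_0 - ... - M_N) g, with m the sum of the M_n, so the remainder of the
    integral is at most the same constant times the integral of g. *)
Lemma is_Cint_series P Fa Fb (E : interval_ends P Fa Fb) (w : R -> C) (g : R -> R) (lg : R)
  (e : nat -> R -> C) (s : R -> C) (M : nat -> R) (I : nat -> C) :
  (forall t, P t -> ccont w t) -> (forall t, P t -> continuous g t) ->
  (forall t, P t -> (Cmod (w t) <= g t)%R) -> is_RInt_gen g Fa Fb lg ->
  (forall n t, P t -> ccont (e n) t) ->
  (forall n t, P t -> (Cmod (e n t) <= M n)%R) -> ex_series M ->
  (forall t, P t -> @is_series C_AbsRing C_NormedModule (fun n => e n t) (s t)) ->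
  (forall n, is_Cint (fun t => w t * e n t) Fa Fb (I n)) ->
  exists l, is_Cint (fun t => w t * s t) Fa Fb l /\ @is_series C_AbsRing C_NormedModule I l.
Proof.
  intros Cw Cg Hwg Ig Ce HM Hex Hs HI.
  pose proof (ends_left _ _ _ E) as FA. pose proof (ends_right _ _ _ E) as FB.
  assert (Cs : forall t, P t -> ccont s t).
  { intros t Pt. apply (continuous_series P e s M t); auto. apply (ends_open _ _ _ E); auto. }
  destruct Hex as [m Hm].
  assert (G0 : forall t, P t -> (0 <= g t)%R)
    by (intros t Pt; eapply Rle_trans; [apply Cmod_ge_0 | apply Hwg, Pt]).
  set (sN := fun N t => @sum_n C_AbelianMonoid (fun n => e n t) N).
  assert (HN : forall N, is_Cint (fun t => w t * sN N t) Fa Fb (@sum_n C_AbelianMonoid I N)).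
  { induction N as [|N IH]; unfold sN.
    - apply (is_Cint_ext P Fa Fb E (fun t => w t * e O t)); [intros; rewrite sum_O; reflexivity|].
      rewrite sum_O. apply HI.
    - apply (is_Cint_ext P Fa Fb E (fun t => w t * sN N t + w t * e (S N) t)).
      + intros; rewrite sum_Sn; unfold sN, plus; simpl; ring.
      + rewrite sum_Sn. apply (is_Cint_plus Fa Fb); [exact IH | exact (HI (S N))]. }
  assert (Tail : forall N t, P t -> (Cmod (w t * s t - w t * sN N t) <= (m - sum_n M N) * g t)%R).
  { intros N t Pt. replace (w t * s t - w t * sN N t) with (w t * (s t - sN N t)) by ring.
    rewrite Cmod_mult, Rmult_comm.
    apply Rmult_le_compat; try apply Cmod_ge_0; [|apply Hwg; auto].
    apply Cmod_series_tail_le; auto. }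
  destruct (is_Cint_dominated P Fa Fb E (fun t => w t * s t - w t * sN O t)
    (fun t => (m - sum_n M O) * g t)%R ((m - sum_n M O) * lg)%R) as [d Hd].
  - intros t Pt. apply continuous_Cplus; [apply continuous_Cmult; auto|].
    apply continuous_Copp, continuous_Cmult; auto. apply continuous_sum_n; auto.
  - intros t Pt. apply (continuous_mult (K := R_AbsRing)); auto. apply continuous_const.
  - intros t Pt. apply Tail; auto.
  - apply (is_RInt_gen_scal (V := R_NormedModule) (Fa := Fa) (Fb := Fb)); auto.
  - exists (d + @sum_n C_AbelianMonoid I O). assert (HS : is_Cint (fun t => w t * s t) Fa Fb (d + @sum_n C_AbelianMonoid I O)).
    { apply (is_Cint_ext P Fa Fb E (fun t => (w t * s t - w t * sN O t) + w t * sN O t)); [intros; ring|].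
      apply (is_Cint_plus Fa Fb); [exact Hd | exact (HN O)]. }
    split; [exact HS|].
    set (l := d + @sum_n C_AbelianMonoid I O) in *.
    apply (filterlim_C_Cmod eventually). intros eps.
    destruct (proj1 (filterlim_locally _ _) (is_lim_series_tail M m lg Hm) eps) as [N0 HN0].
    exists N0. intros N HN'. specialize (HN0 N HN').
    ball_bounds HN0.
    apply Rle_lt_trans with ((m - sum_n M N) * lg)%R; [|lra].
    set (x := @sum_n C_AbelianMonoid I N : C).
    change (Cmod (x - l) <= (m - sum_n M N) * lg)%R.
    replace (x - l) with (- (l - x)) by ring. rewrite Cmod_opp. unfold x.
    apply (Cmod_is_Cint_le P Fa Fb E (fun t => w t * s t - w t * sN N t) (fun t => (m - sum_n M N) * g t)%R).
    + apply Tail.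
    + apply (is_Cint_minus Fa Fb); auto.
    + apply (is_RInt_gen_scal (V := R_NormedModule) (Fa := Fa) (Fb := Fb)); auto.
Qed.

(** * Real majorants *)

Lemma exp_monotone (x y : R) : (x <= y)%R -> (exp x <= exp y)%R.
Proof. intros [H|H]; [left; apply exp_increasing, H | right; rewrite H; reflexivity]. Qed.

Lemma filterlim_power_at_0 (x : R) : (0 < x)%R ->
  filterlim (fun s => exp (x * ln s)) (at_right 0) (locally 0).
Proof.
  intros Hx. apply filterlim_locally. intros eps.
  exists (mkposreal (exp (ln eps / x)) (exp_pos _)). intros s Bs Hs.
  unfold_balls.
  apply Rabs_lt_between in Bs.
  replace (exp (x * ln s) + - 0)%R with (exp (x * ln s)) by ring.
  rewrite Rabs_pos_eq by (left; apply exp_pos).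
  rewrite <- (exp_ln eps) by apply cond_pos. apply exp_increasing.
  assert (ln s < ln eps / x)%R.
  { rewrite <- (ln_exp (ln eps / x)). apply ln_increasing; lra. }
  replace (ln eps) with (x * (ln eps / x))%R by (field; lra).
  apply Rmult_lt_compat_l; auto.
Qed.

Lemma filterlim_reflect : filterlim (fun s => (1 - s)%R) (at_left 1) (at_right 0).
Proof.
  intros Q [d Hd]. exists d. intros s Bs Hs. apply Hd; [|lra].
  unfold_balls.
  apply Rabs_lt_between in Bs. apply Rabs_lt_between. lra.
Qed.

Lemma filterlim_at_right_continuous (f : R -> R) x : continuous f x -> filterlim f (at_right x) (locally (f x)).
Proof. intros H. eapply filterlim_filter_le_1; [|exact H]. apply filter_le_within. Qed.

Lemma filterlim_at_left_continuous (f : R -> R) x : continuous f x -> filterlim f (at_left x) (locally (f x)).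
Proof. intros H. eapply filterlim_filter_le_1; [|exact H]. apply filter_le_within. Qed.

Lemma exp_mult_ln_pred (x t : R) : (0 < t)%R -> (exp ((x - 1) * ln t) = exp (x * ln t) / t)%R.
Proof.
  intros Ht. replace ((x - 1) * ln t)%R with (x * ln t + - ln t)%R by ring.
  rewrite exp_plus, exp_Ropp, exp_ln by exact Ht. reflexivity.
Qed.

Lemma is_derive_continuous_R (f : R -> R) x l : is_derive f x l -> continuous f x.
Proof. intros H. apply (ex_derive_continuous (K := R_AbsRing) (V := R_NormedModule)). exists l; exact H. Qed.

Lemma continuous_exp_ln (c t : R) : (0 < t)%R -> continuous (fun s => exp (c * ln s)) t.
Proof.
  intros Ht. eapply is_derive_continuous_R. auto_derive; [exact Ht | reflexivity].
Qed.
Lemma continuous_exp_ln_reflect (c t : R) : (t < 1)%R -> continuous (fun s => exp (c * ln (1 - s))) t.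
Proof.
  intros Ht. eapply is_derive_continuous_R. auto_derive; [lra | reflexivity].
Qed.

Lemma Rabs_mult_ln_half (c t : R) : (/ 2 <= t <= 1)%R -> (c * ln t <= Rabs c * ln 2)%R.
Proof.
  intros Ht. assert (ln t <= 0)%R by (rewrite <- ln_1; apply ln_le; lra).
  assert (- ln 2 <= ln t)%R by (rewrite <- ln_Rinv by lra; apply ln_le; lra).
  eapply Rle_trans; [apply Rle_abs|]. rewrite Rabs_mult.
  apply Rmult_le_compat_l; [apply Rabs_pos|]. apply Rabs_le. lra.
Qed.

(** On (0, 1/2] the factor (1-t)^(y-1) is bounded and on [1/2, 1) the factor
    t^(x-1) is, so t^(x-1) (1-t)^(y-1) is at most a combination of t^(x-1) and
    (1-t)^(y-1), which have elementary primitives. *)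
Lemma beta_majorant (x y : R) : (0 < x)%R -> (0 < y)%R ->
  exists (g : R -> R) (lg : R),
    (forall t, (0 < t < 1)%R -> continuous g t) /\
    is_RInt_gen g (at_right 0) (at_left 1) lg /\
    (forall t, (0 < t < 1)%R -> (exp ((x - 1) * ln t + (y - 1) * ln (1 - t)) <= g t)%R).
Proof.
  intros Hx Hy.
  set (A := exp (Rabs (y - 1) * ln 2)). set (B := exp (Rabs (x - 1) * ln 2)).
  set (g := fun t => (A * exp ((x - 1) * ln t) + B * exp ((y - 1) * ln (1 - t)))%R).
  set (h := fun t => (A * (exp (x * ln t) / x) + - (B * (exp (y * ln (1 - t)) / y)))%R).
  exists g.
  exists (minus (A * (exp (x * ln 1) / x) + - (B * (0 / y)))%R (A * (0 / x) + - (B * (exp (y * ln (1 - 0)) / y)))%R).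
  assert (Cg : forall t, (0 < t < 1)%R -> continuous g t).
  { intros t Ht. unfold g.
    apply (continuous_plus (V := R_NormedModule) (fun t => A * exp ((x - 1) * ln t))%R (fun t => B * exp ((y - 1) * ln (1 - t)))%R);
    apply (continuous_mult (K := R_AbsRing)); try apply continuous_const;
    [apply continuous_exp_ln | apply continuous_exp_ln_reflect]; lra. }
  assert (Lim : forall F : (R -> Prop) -> Prop, Filter F -> forall (u v : R -> R) (a b : R),
     filterlim u F (locally a) -> filterlim v F (locally b) ->
     filterlim (fun t => (A * (u t / x) + - (B * (v t / y)))%R) F (locally (A * (a / x) + - (B * (b / y)))%R)).
  { intros F FF u v a b Hu Hv.
    apply (filterlim_comp_2 (G := locally (A * (a / x))%R) (H := locally (- (B * (b / y)))%R) (fun t => (A * (u t / x))%R) (fun t => (- (B * (v t / y)))%R) Rplus).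
    - apply (filterlim_comp _ _ _ u (fun z => A * (z / x))%R _ (locally a)); [exact Hu|].
      apply (is_derive_continuous_R (fun z => A * (z / x))%R a (A / x)%R). auto_derive; auto; field; lra.
    - apply (filterlim_comp _ _ _ v (fun z => - (B * (z / y)))%R _ (locally b)); [exact Hv|].
      apply (is_derive_continuous_R (fun z => - (B * (z / y)))%R b (- (B / y))%R). auto_derive; auto; field; lra.
    - apply (filterlim_plus (V := R_NormedModule)). }
  repeat split.
  - exact Cg.
  - apply (is_RInt_gen_primitive (V := R_CompleteNormedModule) _ _ _ ends_unit h g).
    + intros t Ht. unfold h, g. rewrite !exp_mult_ln_pred by lra.
      auto_derive; [lra|]. unfold Rminus. field; lra.
    + exact Cg.
    + apply Lim; [apply at_right_proper_filter | apply filterlim_power_at_0; auto |].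
      apply (filterlim_at_right_continuous (fun t => exp (y * ln (1 - t)))), continuous_exp_ln_reflect; lra.
    + apply Lim; [apply at_left_proper_filter | |].
      * apply (filterlim_at_left_continuous (fun t => exp (x * ln t))), continuous_exp_ln; lra.
      * apply (filterlim_comp _ _ _ (fun t => (1 - t)%R) (fun t => exp (y * ln t)) _ (at_right 0));
        [apply filterlim_reflect | apply filterlim_power_at_0; auto].
  - intros t Ht. rewrite exp_plus. unfold g.
    pose proof (exp_pos ((x - 1) * ln t)). pose proof (exp_pos ((y - 1) * ln (1 - t))).
    pose proof (exp_pos (Rabs (y - 1) * ln 2)). pose proof (exp_pos (Rabs (x - 1) * ln 2)).
    destruct (Rle_dec t (/ 2)).
    + assert (exp ((y - 1) * ln (1 - t)) <= A)%R by (apply exp_monotone, Rabs_mult_ln_half; lra).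
      unfold A, B in *; nra.
    + assert (exp ((x - 1) * ln t) <= B)%R by (apply exp_monotone, Rabs_mult_ln_half; lra).
      unfold A, B in *; nra.
Qed.

Lemma filterlim_ratio_infty (x : R) : (0 < x)%R ->
  filterlim (fun u => exp (x * ln (u / (1 + u))) / x)%R (Rbar_locally p_infty) (locally (/ x)%R).
Proof.
  intros Hx. apply (filterlim_comp _ _ _ (fun u => (u / (1 + u))%R) (fun t => exp (x * ln t) / x)%R _ (locally 1)).
  - change (is_lim (fun u => (u / (1 + u))%R) p_infty 1).
    apply is_lim_ext_loc with (f := fun u => (1 + - / (1 + u))%R).
    { exists 0%R. intros u Hu. field. lra. }
    replace (Finite 1) with (Finite (1 + - 0)) by (f_equal; ring).
    apply (is_lim_plus' (fun _ => 1%R) (fun u => - / (1 + u))%R p_infty 1 (- 0)); [apply is_lim_const|].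
    apply (is_lim_opp _ p_infty 0). 
    replace (Finite 0) with (Rbar_inv p_infty) by reflexivity.
    apply is_lim_inv; [|discriminate].
    eapply is_lim_plus; [apply is_lim_const | apply is_lim_id | reflexivity].
  - replace (/ x)%R with (exp (x * ln 1) / x)%R by (rewrite ln_1, Rmult_0_r, exp_0; field; lra).
    eapply (is_derive_continuous_R (fun t => exp (x * ln t) / x)%R). auto_derive; [lra | reflexivity].
Qed.

(** u^(x-1) (1+u)^(-x-1), the derivative of (u / (1+u))^x / x: near 0 it is of
    the order of the integrand of Gamma(x), and at infinity it still decreases
    like u^(-2). *)
Definition gamma_bound (x u : R) : R := exp ((x - 1) * ln u - (x + 1) * ln (1 + u)).

Lemma continuous_gamma_bound x u : (0 < u)%R -> continuous (gamma_bound x) u.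
Proof.
  intros Hu. unfold gamma_bound. eapply is_derive_continuous_R. auto_derive; [lra | reflexivity].
Qed.

Lemma is_RInt_gen_gamma_bound (x : R) : (0 < x)%R ->
  is_RInt_gen (gamma_bound x) (at_right 0) (Rbar_locally p_infty) (/ x)%R.
Proof.
  intros Hx. replace (/ x)%R with (minus (/ x) 0)%R by (unfold minus, plus, opp; simpl; ring).
  apply (is_RInt_gen_primitive (V := R_CompleteNormedModule) _ _ _ ends_half_line
    (fun u => exp (x * ln (u / (1 + u))) / x)%R).
  - intros u Hu. auto_derive.
    + split; [lra|]. split; [|exact I]. apply Rdiv_lt_0_compat; lra.
    + unfold gamma_bound. change (u * / (1 + u))%R with (u / (1 + u))%R. rewrite ln_div by lra.
      replace ((x - 1) * ln u - (x + 1) * ln (1 + u))%R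
        with (x * (ln u - ln (1 + u)) + - ln u + - ln (1 + u))%R by ring.
      rewrite !exp_plus, !exp_Ropp, !exp_ln by lra. field; lra.
  - apply continuous_gamma_bound.
  - replace 0%R with (0 * / x)%R at 2 by ring.
    apply (filterlim_comp _ _ _ (fun u => exp (x * ln (u / (1 + u)))) (fun z => z * / x)%R _ (locally 0)).
    + apply (filterlim_comp _ _ _ (fun u => (u / (1 + u))%R) (fun z => exp (x * ln z)) _ (at_right 0));
      [|apply filterlim_power_at_0; auto].
      intros Q [d Hd]. exists d. intros u Bu Hu.
      unfold_balls.
      apply Rabs_lt_between in Bu.
      assert (0 < u / (1 + u))%R by (apply Rdiv_lt_0_compat; lra).
      assert (u / (1 + u) <= u)%R by (apply Rle_div_l; nra).
      apply Hd; [|assumption]. apply Rabs_lt_between. lra.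
    + apply (is_derive_continuous_R (fun z => z * / x)%R 0 (/ x)%R). auto_derive; auto; ring.
  - apply filterlim_ratio_infty; auto.
Qed.

(** * The complex beta integral *)

Definition beta_kernel (alpha beta : C) (s : R) : C :=
  Cexp ((alpha - 1) * RtoC (ln s) + (beta - 1) * RtoC (ln (1 - s))).

Definition beta_integral (alpha beta : C) : C :=
  @RInt_gen C_R_CompleteNormedModule (beta_kernel alpha beta) (at_right 0) (at_left 1).

Lemma continuous_Cln (t : R) : (0 < t)%R -> ccont (fun s => RtoC (ln s)) t.
Proof.
  intros Ht. apply continuous_RtoC. eapply is_derive_continuous_R. auto_derive; [exact Ht | reflexivity].
Qed.
Lemma continuous_Cln_reflect (t : R) : (t < 1)%R -> ccont (fun s => RtoC (ln (1 - s))) t.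
Proof.
  intros Ht. apply continuous_RtoC. eapply is_derive_continuous_R. auto_derive; [lra | reflexivity].
Qed.

Lemma continuous_beta_kernel alpha beta t : (0 < t < 1)%R -> ccont (beta_kernel alpha beta) t.
Proof.
  intros Ht. unfold beta_kernel.
  apply (continuous_Cexp (fun s => (alpha - 1) * RtoC (ln s) + (beta - 1) * RtoC (ln (1 - s)))).
  apply continuous_Cplus; apply continuous_Cmult; try apply continuous_Cconst;
  [apply continuous_Cln | apply continuous_Cln_reflect]; lra.
Qed.

Lemma Cmod_beta_kernel alpha beta t :
  Cmod (beta_kernel alpha beta t) = exp ((Re alpha - 1) * ln t + (Re beta - 1) * ln (1 - t)).
Proof. unfold beta_kernel. rewrite Cmod_Cexp. f_equal. unfold Re, Im; simpl. ring. Qed.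

Lemma beta_kernel_majorant (alpha beta : C) : (0 < Re alpha)%R -> (0 < Re beta)%R ->
  exists (g : R -> R) (lg : R),
    (forall t, (0 < t < 1)%R -> continuous g t) /\
    is_RInt_gen g (at_right 0) (at_left 1) lg /\
    (forall t, (0 < t < 1)%R -> (Cmod (beta_kernel alpha beta t) <= g t)%R).
Proof.
  intros Ha Hb. destruct (beta_majorant _ _ Ha Hb) as [g [lg [Cg [Ig Hg]]]].
  exists g, lg. repeat split; auto. intros t Ht. rewrite Cmod_beta_kernel. auto.
Qed.

Lemma is_Cint_RInt_gen P Fa Fb (E : interval_ends P Fa Fb) (f : R -> C) :
  (exists l, is_Cint f Fa Fb l) -> is_Cint f Fa Fb (@RInt_gen C_R_CompleteNormedModule f Fa Fb).
Proof.
  intros H.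
  pose proof (ends_left _ _ _ E) as FA. pose proof (ends_right _ _ _ E) as FB.
  assert (PA : ProperFilter' Fa) by (apply Proper_StrongProper; assumption).
  assert (PB : ProperFilter' Fb) by (apply Proper_StrongProper; assumption).
  apply (RInt_gen_correct (V := C_R_CompleteNormedModule)). exact H.
Qed.

Lemma is_beta_integral (alpha beta : C) : (0 < Re alpha)%R -> (0 < Re beta)%R ->
  is_Cint (beta_kernel alpha beta) (at_right 0) (at_left 1) (beta_integral alpha beta).
Proof.
  intros Ha Hb. apply (is_Cint_RInt_gen _ _ _ ends_unit).
  destruct (beta_kernel_majorant _ _ Ha Hb) as [g [lg [Cg [Ig Hg]]]].
  apply (is_Cint_dominated _ _ _ ends_unit _ g lg); auto.
  intros t Ht. apply continuous_beta_kernel, Ht.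
Qed.

Definition beta_primitive (alpha beta : C) (s : R) : C :=
  Cexp (alpha * RtoC (ln s) + beta * RtoC (ln (1 - s))).

(** The boundary terms of all integrations by parts over (0, 1) vanish. The
    bounded factor phi is what the integrand along a segment carries. *)
Lemma filterlim_beta_primitive (alpha beta : C) (phi : R -> C) (M : R) :
  (0 < Re alpha)%R -> (0 < Re beta)%R ->
  (forall t, (0 < t < 1)%R -> (Cmod (phi t) <= M)%R) ->
  filterlim (fun s => beta_primitive alpha beta s * phi s) (at_right 0) (@locally C_UniformSpace (RtoC 0)) /\
  filterlim (fun s => beta_primitive alpha beta s * phi s) (at_left 1) (@locally C_UniformSpace (RtoC 0)).
Proof.
  intros Ha Hb HM.
  assert (M0 : (0 <= M)%R) by (eapply Rle_trans; [apply Cmod_ge_0 | apply (HM (/2)%R); lra]).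
  assert (NL : forall t, (0 < t < 1)%R -> (ln t <= 0)%R) by (intros t Ht; rewrite <- ln_1; apply ln_le; lra).
  assert (B : forall t, (0 < t < 1)%R -> 
    (Cmod (beta_primitive alpha beta t * phi t) <= exp (Re alpha * ln t) * M)%R /\
    (Cmod (beta_primitive alpha beta t * phi t) <= exp (Re beta * ln (1 - t)) * M)%R).
  { intros t Ht. unfold beta_primitive. rewrite Cmod_mult, Cmod_Cexp.
    pose proof (NL t Ht). pose proof (NL (1 - t)%R ltac:(lra)).
    assert (X : Re (alpha * RtoC (ln t) + beta * RtoC (ln (1 - t))) = (Re alpha * ln t + Re beta * ln (1 - t))%R) by (unfold Re, Im; simpl; ring).
    rewrite X.
    split; apply Rmult_le_compat; try apply Cmod_ge_0; try (left; apply exp_pos); auto; apply exp_monotone; nra. }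
  split; apply filterlim_C_Cmod; try apply at_right_proper_filter; try apply at_left_proper_filter; intros eps.
  - assert (L : filterlim (fun s => exp (Re alpha * ln s) * M)%R (at_right 0) (locally (0 * M)%R)).
    { apply (filterlim_comp _ _ _ (fun s => exp (Re alpha * ln s)) (fun z => z * M)%R _ (locally 0)).
      - apply filterlim_power_at_0; auto.
      - apply (is_derive_continuous_R (fun z => z * M)%R 0%R M). auto_derive; auto; ring. }
    pose proof (proj1 (filterlim_locally _ _) L eps) as L'.
    refine (filter_imp (F := at_right 0) _ _ _ (filter_and (F := at_right 0) _ _ L' (ends_near_left _ _ _ ends_unit (/2)%R ltac:(lra)))).
    intros t [Bt [Pt _]]. destruct (B t Pt) as [B1 _].
    ball_bounds Bt. replace (_ - 0) with (beta_primitive alpha beta t * phi t) by ring. lra.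
  - assert (L : filterlim (fun s => exp (Re beta * ln (1 - s)) * M)%R (at_left 1) (locally (0 * M)%R)).
    { apply (filterlim_comp _ _ _ (fun s => exp (Re beta * ln (1 - s))) (fun z => z * M)%R _ (locally 0)).
      - apply (filterlim_comp _ _ _ (fun s => (1 - s)%R) (fun s => exp (Re beta * ln s)) _ (at_right 0)).
        + apply filterlim_reflect.
        + apply filterlim_power_at_0; auto.
      - apply (is_derive_continuous_R (fun z => z * M)%R 0%R M). auto_derive; auto; ring. }
    pose proof (proj1 (filterlim_locally _ _) L eps) as L'.
    refine (filter_imp (F := at_left 1) _ _ _ (filter_and (F := at_left 1) _ _ L' (ends_near_right _ _ _ ends_unit (/2)%R ltac:(lra)))).
    intros t [Bt [Pt _]]. destruct (B t Pt) as [_ B1].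
    ball_bounds Bt. replace (_ - 0) with (beta_primitive alpha beta t * phi t) by ring. lra.
Qed.

Lemma Cexp_ln (t : R) : (0 < t)%R -> Cexp (RtoC (ln t)) = RtoC t.
Proof. intros Ht. rewrite Cexp_RtoC, exp_ln by exact Ht. reflexivity. Qed.

Lemma beta_primitive_kernel alpha beta t : (0 < t < 1)%R ->
  beta_primitive alpha beta t = beta_kernel alpha beta t * RtoC (t * (1 - t)).
Proof.
  intros Ht. unfold beta_primitive, beta_kernel.
  rewrite RtoC_mult, <- (Cexp_ln t), <- (Cexp_ln (1 - t)), <- !Cexp_plus by lra.
  f_equal. ring.
Qed.

Lemma beta_kernel_succ_r alpha beta t : (0 < t < 1)%R ->
  beta_kernel alpha (beta + 1) t = beta_kernel alpha beta t * RtoC (1 - t).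
Proof.
  intros Ht. unfold beta_kernel.
  rewrite <- (Cexp_ln (1 - t)), <- !Cexp_plus by lra. f_equal. ring.
Qed.

Lemma is_derive_beta_primitive alpha beta t : (0 < t < 1)%R ->
  cderive (beta_primitive alpha beta) t
    (beta_kernel alpha beta t * (alpha * RtoC (1 - t) - beta * RtoC t)).
Proof.
  intros Ht. unfold beta_primitive.
  assert (D1 : cderive (fun s => RtoC (ln s)) t (RtoC (/ t))).
  { apply is_derive_RtoC. auto_derive; [lra | field; lra]. }
  assert (D2 : cderive (fun s => RtoC (ln (1 - s))) t (RtoC (- / (1 - t)))).
  { apply is_derive_RtoC. auto_derive; [lra | field; lra]. }
  pose proof (is_derive_Cexp _ _ _ (is_derive_Cplus _ _ _ _ _ (is_derive_Cscal _ _ _ alpha D1) (is_derive_Cscal _ _ _ beta D2))) as D.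
  match type of D with @is_derive _ _ _ _ ?l => replace (beta_kernel alpha beta t * (alpha * RtoC (1 - t) - beta * RtoC t)) with l; [exact D|] end.
  change (Cexp (alpha * RtoC (ln t) + beta * RtoC (ln (1 - t)))) with (beta_primitive alpha beta t).
  rewrite beta_primitive_kernel by exact Ht.
  assert (RtoC t <> 0) by (intros K; apply RtoC_inj in K; lra).
  assert (RtoC (1 - t) <> 0) by (intros K; apply RtoC_inj in K; lra).
  rewrite RtoC_opp, !RtoC_inv, RtoC_mult by lra. field. auto.
Qed.

(** The derivative of t^alpha (1-t)^beta, with t written 1 - (1 - t), is
    (alpha + beta) t^(alpha-1) (1-t)^beta - beta t^(alpha-1) (1-t)^(beta-1),
    and it integrates to 0. *)
Lemma beta_integral_succ_r (alpha beta : C) : (0 < Re alpha)%R -> (0 < Re beta)%R ->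
  beta * beta_integral alpha beta = (alpha + beta) * beta_integral alpha (beta + 1).
Proof.
  intros Ha Hb.
  assert (Hb1 : (0 < Re (beta + 1))%R) by (unfold Re in *; simpl; lra).
  destruct (filterlim_beta_primitive alpha beta (fun _ => 1) 1 Ha Hb) as [L0 L1].
  { intros; rewrite Cmod_1; lra. }
  assert (D : forall t, (0 < t < 1)%R -> cderive (fun s => beta_primitive alpha beta s * 1) t
            (beta_kernel alpha beta t * (alpha * RtoC (1 - t) - beta * RtoC t))).
  { intros t Ht. apply is_derive_ext with (f := beta_primitive alpha beta).
    - intros; symmetry; apply Cmult_1_r.
    - apply is_derive_beta_primitive, Ht. }
  assert (H0 := is_RInt_gen_primitive (V := C_R_CompleteNormedModule) _ _ _ ends_unit _ _ (RtoC 0) (RtoC 0) D).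
  specialize (fun A => H0 A L0 L1).
  assert (H1 : is_Cint (fun t => (alpha + beta) * beta_kernel alpha (beta + 1) t - beta * beta_kernel alpha beta t)
     (at_right 0) (at_left 1) ((alpha + beta) * beta_integral alpha (beta + 1) - beta * beta_integral alpha beta)).
  { pose proof (ends_left _ _ _ ends_unit) as FA. pose proof (ends_right _ _ _ ends_unit) as FB.
    apply (is_Cint_minus (at_right 0) (at_left 1)); apply (is_Cint_scal (at_right 0) (at_left 1)); apply is_beta_integral; auto. }
  assert (Z : (alpha + beta) * beta_integral alpha (beta + 1) - beta * beta_integral alpha beta = 0 - 0).
  { refine (is_Cint_unique _ _ _ ends_unit _ _ _ _ _ H1 (H0 _)).
    - intros t Ht. simpl. rewrite beta_kernel_succ_r by exact Ht. rewrite RtoC_minus. ring.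
    - intros t Ht. apply continuous_Cmult; [apply continuous_beta_kernel, Ht|].
      apply continuous_Cplus; [|apply continuous_Copp];
      apply continuous_Cmult; try apply continuous_Cconst; apply continuous_RtoC.
      + eapply is_derive_continuous_R. auto_derive; auto.
      + apply continuous_id. }
  replace (beta * beta_integral alpha beta) with ((alpha + beta) * beta_integral alpha (beta + 1) - 
    ((alpha + beta) * beta_integral alpha (beta + 1) - beta * beta_integral alpha beta)) by ring.
  rewrite Z. ring.
Qed.

Lemma beta_integral_1_r (alpha : C) : (0 < Re alpha)%R -> alpha * beta_integral alpha 1 = 1.
Proof.
  intros Ha.
  assert (H1 : is_Cint (fun t => alpha * beta_kernel alpha 1 t) (at_right 0) (at_left 1) (alpha * beta_integral alpha 1)).
  { pose proof (ends_left _ _ _ ends_unit) as FA. pose proof (ends_right _ _ _ ends_unit) as FB.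
    apply (is_Cint_scal (at_right 0) (at_left 1)). apply is_beta_integral; unfold Re in *; simpl; lra. }
  assert (K : forall t, (0 < t)%R -> cderive (fun s => Cexp (alpha * RtoC (ln s))) t (alpha * RtoC (/ t) * Cexp (alpha * RtoC (ln t)))).
  { intros t Ht. apply (is_derive_Cexp (fun s => alpha * RtoC (ln s))), is_derive_Cscal.
    apply is_derive_RtoC. auto_derive; [lra | field; lra]. }
  assert (H0 := is_RInt_gen_primitive (V := C_R_CompleteNormedModule) _ _ _ ends_unit
    (fun s => Cexp (alpha * RtoC (ln s))) (fun t => alpha * RtoC (/ t) * Cexp (alpha * RtoC (ln t))) (RtoC 0) (RtoC 1)).
  transitivity ((1 - 0) : C); [|ring].
  refine (is_Cint_unique _ _ _ ends_unit _ _ _ _ _ H1 (H0 _ _ _ _)).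
  - intros t Ht. simpl. unfold beta_kernel.
    rewrite RtoC_inv by lra. 
    replace ((alpha - 1) * RtoC (ln t) + (1 - 1) * RtoC (ln (1 - t)))
      with (alpha * RtoC (ln t) + - RtoC (ln t)) by ring.
    rewrite Cexp_plus, Cexp_opp, Cexp_ln by lra. ring.
  - intros t Ht. apply K; lra.
  - intros t Ht. apply continuous_Cmult; [apply continuous_Cmult; [apply continuous_Cconst|]|].
    + apply continuous_RtoC. eapply is_derive_continuous_R. auto_derive; [lra|reflexivity].
    + apply continuous_Cexp, continuous_Cmult; [apply continuous_Cconst|]. apply continuous_Cln; lra.
  - apply filterlim_C_Cmod; [apply at_right_proper_filter|]. intros eps.
    pose proof (proj1 (filterlim_locally _ _) (filterlim_power_at_0 _ Ha) eps) as L.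
    refine (filter_imp (F := at_right 0) _ _ _ L). intros t Bt.
    ball_bounds Bt. replace (_ - 0) with (Cexp (alpha * RtoC (ln t))) by ring.
    rewrite Cmod_Cexp. replace (Re (alpha * RtoC (ln t))) with (Re alpha * ln t)%R by (unfold Re, Im; simpl; ring). lra.
  - replace (RtoC 1) with (Cexp (alpha * RtoC (ln 1))) by (rewrite ln_1, Cmult_0_r, Cexp_0; reflexivity).
    eapply filterlim_filter_le_1; [apply filter_le_within|].
    apply (continuous_Cexp (fun t => alpha * RtoC (ln t))), continuous_Cmult; [apply continuous_Cconst | apply continuous_Cln; lra].
Qed.

Lemma Re_pos_neq_0 (z : C) : (0 < Re z)%R -> z <> 0.
Proof. intros H E. rewrite E in H. unfold Re in H; simpl in H. lra. Qed.

Lemma Re_plus (z w : C) : Re (z + w) = (Re z + Re w)%R.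
Proof. reflexivity. Qed.

(** In terms of Gamma both sides will be Gamma(alpha) Gamma(beta) Gamma(1 + n) /
    Gamma(alpha + beta + 1 + n). Here n = 0 is the recurrence
    [beta_integral_succ_r], by which also, from n to n + 1, both sides are
    multiplied by (1 + n) / (alpha + beta + 1 + n). *)
Lemma beta_integral_assoc (alpha beta : C) (n : nat) : (0 < Re alpha)%R -> (0 < Re beta)%R ->
  beta_integral alpha beta * beta_integral (alpha + beta) (1 + RtoC (INR n)) =
  beta_integral beta (1 + RtoC (INR n)) * beta_integral alpha (beta + (1 + RtoC (INR n))).
Proof.
  intros Ha Hb. assert (Hab : (0 < Re (alpha + beta))%R) by (unfold Re in *; simpl; lra).
  pose proof (Re_pos_neq_0 _ Ha) as Na. pose proof (Re_pos_neq_0 _ Hb) as Nb. pose proof (Re_pos_neq_0 _ Hab) as Nab.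
  induction n as [|n IH].
  - simpl INR. replace (1 + RtoC 0) with (RtoC 1) by ring.
    assert (X : forall z, (0 < Re z)%R -> beta_integral z 1 = / z).
    { intros z Hz. pose proof (Re_pos_neq_0 _ Hz). 
      transitivity (/ z * (z * beta_integral z 1)); [field; auto | rewrite beta_integral_1_r by auto; ring]. }
    rewrite !X by auto.
    pose proof (beta_integral_succ_r alpha beta Ha Hb) as S.
    replace (beta_integral alpha beta) with (/ beta * (beta * beta_integral alpha beta)) by (field; auto).
    rewrite S. field. auto.
  - rewrite S_INR, RtoC_plus. set (c := 1 + RtoC (INR n)) in *.
    assert (Hc : (0 < Re c)%R) by (unfold c, Re; simpl; pose proof (pos_INR n); lra).
    replace (1 + (RtoC (INR n) + RtoC 1)) with (c + 1) by (unfold c; ring).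
    replace (beta + (c + 1)) with ((beta + c) + 1) by ring.
    assert (Hbc : (0 < Re (beta + c))%R) by (rewrite Re_plus; lra).
    assert (Habc : (0 < Re (alpha + beta + c))%R) by (rewrite !Re_plus; lra).
    pose proof (Re_pos_neq_0 _ Hbc). pose proof (Re_pos_neq_0 _ Habc).
    pose proof (beta_integral_succ_r (alpha + beta) c Hab Hc) as S1.
    pose proof (beta_integral_succ_r beta c Hb Hc) as S2.
    pose proof (beta_integral_succ_r alpha (beta + c) Ha Hbc) as S3.
    assert (X1 : beta_integral (alpha + beta) (c + 1) = c * beta_integral (alpha + beta) c / (alpha + beta + c)) by (rewrite S1; field; auto).
    assert (X2 : beta_integral beta (c + 1) = c * beta_integral beta c / (beta + c)) by (rewrite S2; field; auto).
    assert (X3 : beta_integral alpha (beta + c + 1) = (beta + c) * beta_integral alpha (beta + c) / (alpha + beta + c)).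
    { rewrite S3. replace (alpha + (beta + c)) with (alpha + beta + c) by ring. field. auto. }
    rewrite X1, X2, X3.
    transitivity (c / (alpha + beta + c) * (beta_integral alpha beta * beta_integral (alpha + beta) c)); [field; auto|].
    rewrite IH. field. auto.
Qed.

(** * The limit formula of Gauss *)

Lemma mean_value_C (f df : R -> C) (a b M : R) : (a <= b)%R ->
  (forall x, (a <= x <= b)%R -> cderive f x (df x)) ->
  (forall x, (a <= x <= b)%R -> ccont df x) ->
  (forall x, (a <= x <= b)%R -> (Cmod (df x) <= M)%R) ->
  (Cmod (f b - f a) <= (b - a) * M)%R.
Proof.
  intros Hab Hd Hc HM.
  assert (E : forall x, (Rmin a b <= x <= Rmax a b)%R -> (a <= x <= b)%R)
    by (intros x; rewrite Rmin_left, Rmax_right by exact Hab; auto).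
  assert (I := is_RInt_derive (V := C_R_CompleteNormedModule) f df a b
    (fun x Hx => Hd x (E x Hx)) (fun x Hx => Hc x (E x Hx))).
  rewrite <- norm_C_R.
  apply (norm_RInt_le_const (V := C_R_NormedModule) df a b); auto.
  intros x Hx. rewrite norm_C_R. auto.
Qed.

Lemma Cmod_Cexp_minus_1 (w : C) : (Cmod (Cexp w - 1) <= Cmod w * Rmax 1 (exp (Re w)))%R.
Proof.
  replace (Cexp w - 1) with (Cexp (RtoC 1 * w) - Cexp (RtoC 0 * w))
    by (rewrite Cmult_1_l, Cmult_0_l, Cexp_0; reflexivity).
  replace (Cmod w * Rmax 1 (exp (Re w)))%R with ((1 - 0) * (Cmod w * Rmax 1 (exp (Re w))))%R by ring.
  apply (mean_value_C (fun t => Cexp (RtoC t * w)) (fun t => (1 * w + RtoC t * 0) * Cexp (RtoC t * w))); [lra| | |].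
  - intros t Ht. apply (is_derive_Cexp (fun t => RtoC t * w)), is_derive_Cmult; [|apply is_derive_Cconst].
    apply is_derive_RtoC, (is_derive_id (K := R_AbsRing)).
  - intros t Ht. apply continuous_Cmult; [|apply continuous_Cexp]; 
    [apply continuous_Cplus|]; apply continuous_Cmult; try apply continuous_Cconst; apply continuous_RtoC, continuous_id.
  - intros t Ht. rewrite Cmod_mult, Cmod_Cexp. replace (1 * w + RtoC t * 0) with w by ring.
    apply Rmult_le_compat_l; [apply Cmod_ge_0|].
    replace (Re (RtoC t * w)) with (t * Re w)%R by (unfold Re, Im; simpl; ring).
    destruct (Rle_dec (Re w) 0).
    + eapply Rle_trans; [|apply Rmax_l]. rewrite <- exp_0. apply exp_monotone. nra.
    + eapply Rle_trans; [|apply Rmax_r]. apply exp_monotone. nra.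
Qed.

Lemma ln_1_plus_le (x : R) : (-1 < x)%R -> (ln (1 + x) <= x)%R.
Proof.
  intros Hx. rewrite <- (ln_exp x) at 2. apply ln_le; [lra|]. apply exp_ineq1_le.
Qed.

Lemma ln_1_plus_ge (x : R) : (0 <= x)%R -> (x / (1 + x) <= ln (1 + x))%R.
Proof.
  intros Hx. assert (H : (ln (1 + - (x / (1 + x))) <= - (x / (1 + x)))%R).
  { apply ln_1_plus_le. assert (x / (1 + x) < 1)%R by (apply Rlt_div_l; lra). lra. }
  replace (1 + - (x / (1 + x)))%R with (/ (1 + x))%R in H by (field; lra).
  rewrite ln_Rinv in H by lra. lra.
Qed.

(** (1 + u/m)^m increases with m, also for real m. With q the quotient of
    1 + u/m by 1 + u/n, this follows from ln q <= q - 1 and from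
    ln (1 + x) >= x / (1 + x) at x = u/n. *)
Lemma compound_interest_monotone (m n u : R) : (0 < m)%R -> (m <= n)%R -> (0 <= u)%R ->
  (m * ln (1 + u / m) <= n * ln (1 + u / n))%R.
Proof.
  intros Hm Hn Hu.
  assert (P : (0 <= u / n)%R) by (apply Rdiv_le_0_compat; lra).
  assert (P' : (0 <= u / m)%R) by (apply Rdiv_le_0_compat; lra).
  set (q := ((1 + u / m) / (1 + u / n))%R).
  assert (Q : (0 < q)%R) by (apply Rdiv_lt_0_compat; lra).
  assert (A : (ln q <= q - 1)%R).
  { replace q with (1 + (q - 1))%R at 1 by ring. apply ln_1_plus_le. lra. }
  assert (B : ln q = (ln (1 + u / m) - ln (1 + u / n))%R) by (apply ln_div; lra).
  pose proof (ln_1_plus_ge _ P) as D.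
  assert (F : (m * (q - 1) = (n - m) * (u / n / (1 + u / n)))%R) by (unfold q; field; repeat split; nra).
  assert (G : ((n - m) * (u / n / (1 + u / n)) <= (n - m) * ln (1 + u / n))%R) by (apply Rmult_le_compat_l; lra).
  assert (H : (m * ln q <= m * (q - 1))%R) by (apply Rmult_le_compat_l; lra).
  rewrite B in H. lra.
Qed.

Lemma compound_interest_ge (m n u : R) : (1 <= m)%R -> (m <= n)%R -> (0 <= u)%R ->
  (m * ln (1 + u) - m * ln m <= n * ln (1 + u / n))%R.
Proof.
  intros Hm Hn Hu. eapply Rle_trans; [|apply (compound_interest_monotone m n); lra].
  rewrite <- Rmult_minus_distr_l. apply Rmult_le_compat_l; [lra|].
  rewrite <- ln_div by lra. apply ln_le; [apply Rdiv_lt_0_compat; lra|].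
  apply Rle_div_l; [lra|]. replace ((1 + u / m) * m)%R with (m + u)%R by (field; lra). lra.
Qed.

Lemma linear_ge_log (m u : R) : (1 <= m)%R -> (0 <= u)%R -> (m * ln (1 + u) - m * ln m <= u)%R.
Proof.
  intros Hm Hu. eapply Rle_trans; [apply (compound_interest_ge m m); lra|].
  assert (P' : (0 <= u / m)%R) by (apply Rdiv_le_0_compat; lra).
  replace u with (m * (u / m))%R at 2 by (field; lra). apply Rmult_le_compat_l; [lra|].
  apply ln_1_plus_le. lra.
Qed.

Definition gamma_kernel (alpha : C) (u : R) : C :=
  Cexp ((alpha - 1) * RtoC (ln u) + RtoC (- u)).

Lemma continuous_gamma_kernel alpha u : (0 < u)%R -> ccont (gamma_kernel alpha) u.
Proof.
  intros Hu. unfold gamma_kernel.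
  apply (continuous_Cexp (fun s => (alpha - 1) * RtoC (ln s) + RtoC (- s))).
  apply continuous_Cplus; [apply continuous_Cmult; [apply continuous_Cconst | apply continuous_Cln, Hu]|].
  apply continuous_RtoC. eapply is_derive_continuous_R. auto_derive; auto.
Qed.

Lemma Cmod_gamma_kernel alpha u : Cmod (gamma_kernel alpha u) = exp ((Re alpha - 1) * ln u - u).
Proof. unfold gamma_kernel. rewrite Cmod_Cexp. f_equal. unfold Re, Im; simpl. ring. Qed.

Lemma is_euler_integral (alpha : C) : (0 < Re alpha)%R ->
  is_Cint (gamma_kernel alpha) (at_right 0) (Rbar_locally p_infty) (euler_integral alpha).
Proof.
  intros Ha. unfold euler_integral.
  apply (is_Cint_ext _ _ _ ends_half_line (fun u => Rpowc u (alpha - 1) * RtoC (exp (- u)))).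
  { intros u Hu. unfold gamma_kernel, Rpowc. rewrite Cexp_plus, (Cexp_RtoC (- u)). reflexivity. }
  apply (is_Cint_RInt_gen _ _ _ ends_half_line).
  set (x := Re alpha) in *. set (m := (x + 1)%R).
  destruct (is_Cint_dominated _ _ _ ends_half_line (gamma_kernel alpha)
    (fun u => exp (m * ln m) * gamma_bound x u)%R (exp (m * ln m) * / x)%R) as [l Hl].
  - apply continuous_gamma_kernel.
  - intros t Ht. apply (continuous_mult (K := R_AbsRing)); [apply continuous_const | apply continuous_gamma_bound, Ht].
  - intros u Hu. rewrite Cmod_gamma_kernel. unfold gamma_bound. rewrite <- exp_plus.
    apply exp_monotone. pose proof (linear_ge_log m u) as H. unfold m, x in *. specialize (H ltac:(lra) ltac:(lra)). lra.
  - pose proof (ends_left _ _ _ ends_half_line) as FA. pose proof (ends_right _ _ _ ends_half_line) as FB.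
    apply (is_RInt_gen_scal (V := R_NormedModule)). apply is_RInt_gen_gamma_bound, Ha.
  - exists l. apply (is_Cint_ext _ _ _ ends_half_line (gamma_kernel alpha)); auto.
    intros u Hu. unfold gamma_kernel, Rpowc. rewrite Cexp_plus, (Cexp_RtoC (- u)). reflexivity.
Qed.

Lemma Gamma_euler (alpha : C) : (0 < Re alpha)%R -> Gamma alpha = euler_integral alpha.
Proof.
  intros Ha. unfold Gamma.
  assert (H : (up (- Re alpha) <= 0)%Z).
  { apply Z.lt_succ_r, lt_IZR. rewrite succ_IZR. simpl. destruct (archimed (- Re alpha)) as [_ H]. lra. }
  replace (Z.to_nat (up (- Re alpha))) with O by lia. simpl.
  replace (alpha + RtoC 0) with alpha by ring. field.
Qed.

(** u^(alpha-1) (1 + u/n)^(-(delta+n)), which tends to u^(alpha-1) e^(-u) as n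
    grows. *)
Definition gauss_kernel (alpha delta : C) (n u : R) : C :=
  Cexp ((alpha - 1) * RtoC (ln u) - (delta + RtoC n) * RtoC (ln (1 + u / n))).

(** The substitution s = u / (n + u) turns the beta integral into an integral
    over the half-line: 1 - s = n / (n + u), so 1 - s = 1 / (1 + u/n). *)
Lemma is_Cint_gauss_kernel (alpha gamma : C) (n : R) :
  (0 < Re alpha)%R -> (0 < Re gamma)%R -> (0 < n)%R ->
  is_Cint (gauss_kernel alpha (alpha + gamma) n) (at_right 0) (Rbar_locally p_infty)
    (Cexp (alpha * RtoC (ln n)) * beta_integral alpha (gamma + RtoC n)).
Proof.
  intros Ha Hg Hn.
  assert (Hgn : (0 < Re (gamma + RtoC n))%R) by (rewrite Re_plus; simpl; lra).
  pose proof (ends_left _ _ _ ends_half_line) as FA. pose proof (ends_right _ _ _ ends_half_line) as FB.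
  assert (U : forall u, (0 < u)%R -> (0 < u / (n + u) < 1)%R).
  { intros u Hu. split; [apply Rdiv_lt_0_compat; lra | apply Rlt_div_l; lra]. }
  apply (is_Cint_ext _ _ _ ends_half_line
    (fun u => Cexp (alpha * RtoC (ln n)) *
       @scal _ C_R_ModuleSpace (n / (n + u) ^ 2)%R (beta_kernel alpha (gamma + RtoC n) (u / (n + u))%R))).
  - intros u Hu. rewrite scal_R_Cmult. unfold gauss_kernel, beta_kernel.
    replace (1 - u / (n + u))%R with (n / (n + u))%R by (field; lra).
    replace (1 + u / n)%R with ((n + u) / n)%R by (field; lra).
    rewrite !ln_div by lra.
    replace (RtoC (n / (n + u) ^ 2)) with (Cexp (RtoC (ln n - 2 * ln (n + u)))).
    + rewrite <- !Cexp_plus. f_equal. rewrite ?RtoC_minus, ?RtoC_mult. ring.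
    + rewrite Cexp_RtoC. f_equal. replace (ln n - 2 * ln (n + u))%R with (ln n + - ln (n + u) + - ln (n + u))%R by ring.
      rewrite !exp_plus, !exp_Ropp, !exp_ln by lra. field. lra.
  - apply (is_Cint_scal (at_right 0) (Rbar_locally p_infty)).
    apply (is_RInt_gen_subst (V := C_R_CompleteNormedModule) (fun u => (0 < u)%R) (at_right 0) (Rbar_locally p_infty) (at_right 0) (at_left 1)
      (beta_kernel alpha (gamma + RtoC n)) (fun u => (u / (n + u))%R) (fun u => (n / (n + u) ^ 2)%R)).
    + intros x y z Hx Hy Hz. pose proof (Rmin_glb_lt x y 0 Hx Hy). lra.
    + refine (filter_imp (F := at_right 0) _ _ _ (ends_near_left _ _ _ ends_half_line 1%R ltac:(lra))). tauto.
    + refine (filter_imp (F := Rbar_locally p_infty) _ _ _ (ends_near_right _ _ _ ends_half_line 1%R ltac:(lra))). tauto.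
    + intros u Hu. apply continuous_beta_kernel, U, Hu.
    + intros u Hu. auto_derive; [lra | field; lra].
    + intros u Hu. eapply is_derive_continuous_R. auto_derive; [|reflexivity]. nra.
    + intros Q [d Hd]. assert (P : (0 < d * n)%R) by (apply Rmult_lt_0_compat; [apply cond_pos | lra]).
      exists (mkposreal _ P). intros u Bu Hu.
      unfold_balls.
      apply Rabs_lt_between in Bu. pose proof (U u Hu).
      apply Hd; [|apply U; lra]. apply Rabs_lt_between.
      assert (u / (n + u) < d)%R. { apply Rlt_div_l; [lra|]. pose proof (cond_pos d). nra. }
      lra.
    + intros Q [d Hd]. exists (Rmax 0 (n / d)). intros u Hu. pose proof (Rmax_l 0 (n / d)). pose proof (Rmax_r 0 (n / d)).
      pose proof (cond_pos d) as Pd. assert (u0 : (0 < u)%R) by lra. pose proof (U u u0).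
      apply Hd; [|apply U, u0].
      unfold_ball. apply Rabs_lt_between.
      assert (1 - u / (n + u) < d)%R.
      { replace (1 - u / (n + u))%R with (n / (n + u))%R by (field; lra). apply Rlt_div_l; [lra|].
        assert (n < u * d)%R by (apply Rlt_div_l; lra). nra. }
      lra.
    + apply is_beta_integral; auto.
Qed.

(** The kernel is u^(alpha-1) e^(-u) e^w with
    w = u - (n + delta) ln (1 + u/n), and |w| <= (u^2 + |delta| u) / n. As
    |e^w - 1| <= |w| max(1, |e^w|) and both e^(-u) and e^(-u) |e^w| are at most
    constant times (1+u)^(-m), the choice m = Re alpha + 3 leaves an integrable
    bound after absorbing the quadratic factor of w. *)
Lemma Cmod_gauss_minus_gamma (alpha delta : C) (n u : R) :
  let x := Re alpha in let m := (x + 3)%R in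
  (0 < x)%R -> (0 < Re delta)%R -> (m <= n)%R -> (0 < u)%R ->
  (Cmod (gauss_kernel alpha delta n u - gamma_kernel alpha u)
   <= (1 + Cmod delta) * exp (m * ln m) / n * gamma_bound x u)%R.
Proof.
  intros x m Hx Hd Hn Hu.
  assert (P : (0 <= u / n)%R) by (apply Rdiv_le_0_compat; unfold m in *; lra).
  set (l := ln (1 + u / n)).
  assert (L0 : (0 <= l)%R) by (unfold l; rewrite <- ln_1; apply ln_le; lra).
  assert (L1 : (l <= u / n)%R) by (apply ln_1_plus_le; lra).
  assert (n0 : (0 < n)%R) by (unfold m in *; lra).
  assert (L2 : (u - n * l <= u ^ 2 / n)%R).
  { pose proof (ln_1_plus_ge _ P) as A. fold l in A.
    assert (B : (n * (u / n / (1 + u / n)) <= n * l)%R) by (apply Rmult_le_compat_l; lra).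
    assert (D : (u - n * (u / n / (1 + u / n)) <= u ^ 2 / n)%R).
    { replace (u - n * (u / n / (1 + u / n)))%R with (u ^ 2 / (n + u))%R by (field; lra).
      unfold Rdiv. apply Rmult_le_compat_l; [nra|]. apply Rinv_le_contravar; lra. }
    lra. }
  assert (L3 : (0 <= u - n * l)%R).
  { assert (n * l <= n * (u / n))%R by (apply Rmult_le_compat_l; lra).
    replace (n * (u / n))%R with u in * by (field; lra). lra. }
  set (w := RtoC (u - n * l) - delta * RtoC l).
  assert (E : gauss_kernel alpha delta n u - gamma_kernel alpha u = gamma_kernel alpha u * (Cexp w - 1)).
  { assert (G : gauss_kernel alpha delta n u = gamma_kernel alpha u * Cexp w).
    { unfold gauss_kernel, gamma_kernel. fold l. rewrite <- Cexp_plus. f_equal. unfold w.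
      rewrite ?RtoC_minus, ?RtoC_mult, ?RtoC_opp. ring. }
    rewrite G. ring. }
  rewrite E, Cmod_mult, Cmod_gamma_kernel. fold x.
  assert (W : (Cmod w <= (1 + Cmod delta) / n * (1 + u) ^ 2)%R).
  { unfold w. unfold Cminus. eapply Rle_trans; [apply Cmod_triangle|].
    rewrite Cmod_opp, Cmod_mult, !Cmod_R, !Rabs_pos_eq by lra.
    pose proof (Cmod_ge_0 delta) as D0.
    assert (Cmod delta * l <= Cmod delta * (u / n))%R by (apply Rmult_le_compat_l; lra).
    assert (X : (u ^ 2 / n + Cmod delta * (u / n) <= (1 + Cmod delta) / n * (1 + u) ^ 2)%R).
    { replace (u ^ 2 / n + Cmod delta * (u / n))%R with ((u ^ 2 + Cmod delta * u) * / n)%R by (field; lra).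
      replace ((1 + Cmod delta) / n * (1 + u) ^ 2)%R with ((1 + Cmod delta) * (1 + u) ^ 2 * / n)%R by (field; lra).
      apply Rmult_le_compat_r; [left; apply Rinv_0_lt_compat; lra|]. nra. }
    lra. }
  assert (M : (exp (- u) * Rmax 1 (exp (Re w)) <= exp (m * ln m - m * ln (1 + u)))%R).
  { assert (Rw : Re w = (u - n * l - Re delta * l)%R) by (unfold w, Re, Im; simpl; ring).
    pose proof (compound_interest_ge m n u ltac:(unfold m; lra) Hn ltac:(lra)) as A. fold l in A.
    pose proof (linear_ge_log m u ltac:(unfold m; lra) ltac:(lra)) as B.
    unfold Rmax. destruct (Rle_dec 1 (exp (Re w))).
    - rewrite <- exp_plus. apply exp_monotone. rewrite Rw. nra.
    - rewrite Rmult_1_r. apply exp_monotone. lra. }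
  assert (G : gamma_bound x u = (exp ((x - 1) * ln u) * (1 + u) ^ 2 * exp (- (m * ln (1 + u))))%R).
  { unfold gamma_bound. replace ((1 + u) ^ 2)%R with (exp (ln (1 + u)) * exp (ln (1 + u)))%R by (rewrite exp_ln by lra; ring).
    rewrite <- !exp_plus. f_equal. unfold m. ring. }
  rewrite G. unfold Rminus at 1. rewrite exp_plus.
  pose proof (Cmod_Cexp_minus_1 w) as Q.
  pose proof (exp_pos ((x - 1) * ln u)) as p1. pose proof (exp_pos (- u)) as p2.
  unfold Rminus in M. rewrite exp_plus in M.
  set (A := exp ((x - 1) * ln u)) in *. set (B := exp (- u)) in *. set (R1 := Rmax 1 (exp (Re w))) in *.
  set (T := exp (m * ln m)) in *. set (S := exp (- (m * ln (1 + u)))) in *.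
  pose proof (Cmod_ge_0 w). 
  assert (R0 : (0 <= R1)%R) by (unfold R1; eapply Rle_trans; [|apply Rmax_l]; lra).
  apply Rle_trans with (A * (Cmod w * (B * R1)))%R.
  { replace (A * (Cmod w * (B * R1)))%R with (A * B * (Cmod w * R1))%R by ring.
    apply Rmult_le_compat_l; [nra | exact Q]. }
  replace ((1 + Cmod delta) * T / n * (A * (1 + u) ^ 2 * S))%R
    with (A * ((1 + Cmod delta) / n * (1 + u) ^ 2 * (T * S)))%R by (field; lra).
  apply Rmult_le_compat_l; [lra|]. apply Rmult_le_compat; auto. nra.
Qed.

Lemma gauss_limit (alpha gamma : C) : (0 < Re alpha)%R -> (0 < Re gamma)%R ->
  filterlim (fun n => Cexp (alpha * RtoC (ln (INR n))) * beta_integral alpha (gamma + RtoC (INR n)))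
    eventually (@locally C_UniformSpace (euler_integral alpha)).
Proof.
  intros Ha Hg. apply (filterlim_C_Cmod eventually). intros eps.
  set (x := Re alpha) in *. set (m := (x + 3)%R).
  assert (Hd : (0 < Re (alpha + gamma))%R) by (rewrite Re_plus; unfold x in *; lra).
  set (K := ((1 + Cmod (alpha + gamma)) * exp (m * ln m) * / x)%R).
  destruct (nfloor_ex (Rmax m (Rmax 0 (K / eps))) ltac:(eapply Rle_trans; [|apply Rmax_r]; apply Rmax_l)) as [N [_ HN]].
  exists (S N). intros k Hk. apply le_INR in Hk. rewrite S_INR in Hk.
  set (n := INR k) in *.
  pose proof (Rmax_l m (Rmax 0 (K / eps))). pose proof (Rmax_r m (Rmax 0 (K / eps))). pose proof (Rmax_r 0 (K / eps)).
  assert (Hm : (m <= n)%R) by lra. assert (HK : (K / eps < n)%R) by lra.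
  assert (n0 : (0 < n)%R) by (unfold m in *; lra).
  pose proof (ends_left _ _ _ ends_half_line) as FA. pose proof (ends_right _ _ _ ends_half_line) as FB.
  apply Rle_lt_trans with ((1 + Cmod (alpha + gamma)) * exp (m * ln m) / n * / x)%R.
  - apply (Cmod_is_Cint_le _ _ _ ends_half_line
      (fun u => gauss_kernel alpha (alpha + gamma) n u - gamma_kernel alpha u)
      (fun u => (1 + Cmod (alpha + gamma)) * exp (m * ln m) / n * gamma_bound x u)%R).
    + intros u Hu. apply Cmod_gauss_minus_gamma; auto.
    + apply (is_Cint_minus (at_right 0) (Rbar_locally p_infty)).
      * apply is_Cint_gauss_kernel; auto.
      * apply is_euler_integral; auto.
    + apply (is_RInt_gen_scal (V := R_NormedModule)). apply is_RInt_gen_gamma_bound; auto.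
  - replace ((1 + Cmod (alpha + gamma)) * exp (m * ln m) / n * / x)%R with (K / n)%R by (unfold K; field; unfold x in *; lra).
    pose proof (cond_pos eps). apply Rlt_div_l; [lra|]. rewrite Rmult_comm. apply Rlt_div_l in HK; lra.
Qed.

Lemma filterlim_Cmult {T} (F : (T -> Prop) -> Prop) {FF : Filter F} (f g : T -> C) (a b : C) :
  filterlim f F (@locally C_UniformSpace a) -> filterlim g F (@locally C_UniformSpace b) ->
  filterlim (fun x => f x * g x) F (@locally C_UniformSpace (a * b)).
Proof.
  intros Hf Hg.
  pose proof (filterlim_Re F f a Hf). pose proof (filterlim_Im F f a Hf).
  pose proof (filterlim_Re F g b Hg). pose proof (filterlim_Im F g b Hg).
  apply (filterlim_C F); simpl.
  - apply (filterlim_comp_2 (G := locally (Re a * Re b)%R) (H := locally (- (Im a * Im b))%R)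
      (fun x => (Re (f x) * Re (g x))%R) (fun x => (- (Im (f x) * Im (g x)))%R) Rplus).
    + eapply filterlim_comp_2; [eassumption | eassumption | apply (filterlim_mult (K := R_AbsRing))].
    + eapply filterlim_comp; [|apply (filterlim_opp (V := R_NormedModule))].
      eapply filterlim_comp_2; [eassumption | eassumption | apply (filterlim_mult (K := R_AbsRing))].
    + apply (filterlim_plus (V := R_NormedModule)).
  - apply (filterlim_comp_2 (G := locally (Re a * Im b)%R) (H := locally (Im a * Re b)%R)
      (fun x => (Re (f x) * Im (g x))%R) (fun x => (Im (f x) * Re (g x))%R) Rplus).
    + eapply filterlim_comp_2; [eassumption | eassumption | apply (filterlim_mult (K := R_AbsRing))].
    + eapply filterlim_comp_2; [eassumption | eassumption | apply (filterlim_mult (K := R_AbsRing))].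
    + apply (filterlim_plus (V := R_NormedModule)).
Qed.

Lemma beta_integral_euler (alpha beta : C) : (0 < Re alpha)%R -> (0 < Re beta)%R ->
  beta_integral alpha beta * euler_integral (alpha + beta) = euler_integral alpha * euler_integral beta.
Proof.
  intros Ha Hb. assert (Hab : (0 < Re (alpha + beta))%R) by (rewrite Re_plus; lra).
  assert (H1 : (0 < Re 1)%R) by (simpl; lra).
  assert (Hb1 : (0 < Re (beta + 1))%R) by (rewrite Re_plus; simpl; lra).
  pose proof (filterlim_Cmult eventually _ _ _ _ (gauss_limit alpha (beta + 1) Ha Hb1) (gauss_limit beta 1 Hb H1)) as R1.
  pose proof (filterlim_Cmult eventually (fun _ => beta_integral alpha beta) _ _ _ (filterlim_const _) (gauss_limit (alpha + beta) 1 Hab H1)) as R2.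
  refine (@filterlim_locally_unique nat R_AbsRing C_R_NormedModule eventually _ _ _ _ R2 _).
  revert R1. apply filterlim_ext. intros n. simpl.
  replace ((alpha + beta) * RtoC (ln (INR n))) with (alpha * RtoC (ln (INR n)) + beta * RtoC (ln (INR n))) by ring.
  rewrite Cexp_plus. replace (beta + 1 + RtoC (INR n)) with (beta + (1 + RtoC (INR n))) by ring.
  transitivity (Cexp (alpha * RtoC (ln (INR n))) * Cexp (beta * RtoC (ln (INR n))) * 
    (beta_integral alpha beta * beta_integral (alpha + beta) (1 + RtoC (INR n)))); [|ring].
  rewrite beta_integral_assoc by auto. ring.
Qed.

(** * The Gamma function *)

Lemma gamma_kernel_succ (z : C) u : (0 < u)%R ->
  gamma_kernel (z + 1) u = gamma_kernel z u * RtoC u.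
Proof.
  intros Hu. rewrite <- (Cexp_ln u) by exact Hu. unfold gamma_kernel.
  rewrite <- Cexp_plus. f_equal. ring.
Qed.

Lemma Cmod_gamma_kernel_succ_le (z : C) u : (0 < Re z)%R -> (0 < u)%R ->
  let m := (Re z + 1)%R in
  (Cmod (gamma_kernel (z + 1) u) <= exp (Re z * ln u))%R /\
  (Cmod (gamma_kernel (z + 1) u) <= exp (m * ln m) / (1 + u))%R.
Proof.
  intros Hz Hu m. rewrite Cmod_gamma_kernel.
  replace (Re (z + 1) - 1)%R with (Re z) by (unfold Re; simpl; ring).
  split.
  - apply exp_monotone. lra.
  - unfold Rdiv. rewrite <- (exp_ln (1 + u)) at 1 by lra. rewrite <- exp_Ropp, <- exp_plus. apply exp_monotone.
    pose proof (linear_ge_log m u ltac:(unfold m; lra) ltac:(lra)) as L.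
    assert (ln u <= ln (1 + u))%R by (apply ln_le; lra). 
    unfold m in *. nra.
Qed.

(** Integration by parts: the derivative of u^z e^(-u) is
    z u^(z-1) e^(-u) - u^z e^(-u), and u^z e^(-u) vanishes at both ends. *)
Lemma euler_integral_succ (z : C) : (0 < Re z)%R -> euler_integral (z + 1) = z * euler_integral z.
Proof.
  intros Hz. assert (Hz1 : (0 < Re (z + 1))%R) by (rewrite Re_plus; simpl; lra).
  pose proof (ends_left _ _ _ ends_half_line) as FA. pose proof (ends_right _ _ _ ends_half_line) as FB.
  assert (D : forall u, (0 < u)%R -> cderive (gamma_kernel (z + 1)) u (z * gamma_kernel z u - gamma_kernel (z + 1) u)).
  { intros u Hu. rewrite gamma_kernel_succ by exact Hu.
    assert (D1 : cderive (fun s => RtoC (ln s)) u (RtoC (/ u))) by (apply is_derive_RtoC; auto_derive; [lra | field; lra]).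
    assert (D2 : cderive (fun s => RtoC (- s)) u (RtoC (-1))) by (apply is_derive_RtoC; auto_derive; auto; ring).
    pose proof (is_derive_Cexp _ _ _ (is_derive_Cplus _ _ _ _ _ (is_derive_Cscal _ _ _ (z + 1 - 1) D1) D2)) as D.
    match type of D with @is_derive _ _ _ _ ?l => replace (z * gamma_kernel z u - gamma_kernel z u * RtoC u) with l; [exact D|] end.
    cbv beta. fold (gamma_kernel (z + 1) u). rewrite gamma_kernel_succ by exact Hu.
    assert (RtoC u <> 0) by (intros K; apply RtoC_inj in K; lra).
    rewrite RtoC_inv by lra.
    replace (RtoC (-1)) with (- RtoC 1) by (rewrite <- RtoC_opp; f_equal; ring). field. auto. }
  assert (H0 : is_Cint (fun u => z * gamma_kernel z u - gamma_kernel (z + 1) u) (at_right 0) (Rbar_locally p_infty) (0 - 0)).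
  { apply (is_RInt_gen_primitive (V := C_R_CompleteNormedModule) _ _ _ ends_half_line _ _ (RtoC 0) (RtoC 0) D).
    - intros u Hu. apply continuous_Cplus; [apply continuous_Cmult; [apply continuous_Cconst|] | apply continuous_Copp];
      apply continuous_gamma_kernel, Hu.
    - apply filterlim_C_Cmod; [exact _|]. intros eps.
      pose proof (proj1 (filterlim_locally _ _) (filterlim_power_at_0 _ Hz) eps) as L.
      refine (filter_imp (F := at_right 0) _ _ _ (filter_and (F := at_right 0) _ _ L (ends_near_left _ _ _ ends_half_line 1%R ltac:(lra)))).
      intros u [Bu [Hu _]].
      ball_bounds Bu. destruct (Cmod_gamma_kernel_succ_le z u Hz Hu) as [B _].
      replace (_ - 0) with (gamma_kernel (z + 1) u) by ring. lra.
    - apply filterlim_C_Cmod; [exact _|]. intros eps. pose proof (cond_pos eps) as Pe.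
      set (m := (Re z + 1)%R). exists (Rmax 0 (exp (m * ln m) / eps)). intros u Hu.
      pose proof (Rmax_l 0 (exp (m * ln m) / eps)). pose proof (Rmax_r 0 (exp (m * ln m) / eps)).
      destruct (Cmod_gamma_kernel_succ_le z u Hz ltac:(lra)) as [_ B]. fold m in B.
      replace (_ - 0) with (gamma_kernel (z + 1) u) by ring.
      eapply Rle_lt_trans; [exact B|]. apply Rlt_div_l; [lra|].
      assert (exp (m * ln m) < u * eps)%R by (apply Rlt_div_l; lra). nra. }
  assert (H1 : is_Cint (fun u => z * gamma_kernel z u - gamma_kernel (z + 1) u) (at_right 0) (Rbar_locally p_infty)
     (z * euler_integral z - euler_integral (z + 1))).
  { apply (is_Cint_minus (at_right 0) (Rbar_locally p_infty)); [apply (is_Cint_scal (at_right 0) (Rbar_locally p_infty))|];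
    apply is_euler_integral; auto. }
  pose proof (is_Cint_unique _ _ _ ends_half_line _ _ _ _ (fun _ _ => eq_refl) H1 H0) as Z.
  replace (euler_integral (z + 1)) with (z * euler_integral z - (z * euler_integral z - euler_integral (z + 1))) by ring.
  rewrite Z. ring.
Qed.

Lemma Gamma_succ (z : C) : (0 < Re z)%R -> Gamma (z + 1) = z * Gamma z.
Proof.
  intros Hz. rewrite !Gamma_euler; [apply euler_integral_succ, Hz | exact Hz | rewrite Re_plus; simpl; lra].
Qed.

Lemma Gamma_1 : Gamma 1 = 1.
Proof.
  rewrite Gamma_euler by (simpl; lra).
  assert (H : is_Cint (gamma_kernel 1) (at_right 0) (Rbar_locally p_infty) (RtoC (-0) - RtoC (-1))).
  { apply (is_RInt_gen_primitive (V := C_R_CompleteNormedModule) _ _ _ ends_half_line (fun u => RtoC (- exp (- u))) (gamma_kernel 1) (RtoC (-1)) (RtoC (-0))).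
    - intros u Hu. replace (gamma_kernel 1 u) with (RtoC (exp (- u))).
      + apply is_derive_RtoC. auto_derive; auto; ring.
      + unfold gamma_kernel. rewrite <- Cexp_RtoC. f_equal. ring.
    - apply continuous_gamma_kernel.
    - apply filterlim_C; [exact _| |].
      + replace (Re (RtoC (-1))) with (- exp (- 0))%R by (simpl; rewrite Ropp_0, exp_0; ring).
        apply (filterlim_at_right_continuous (fun u => - exp (- u))%R). eapply is_derive_continuous_R. auto_derive; [auto | reflexivity].
      + simpl. apply (filterlim_const (F := _) (0%R : R_UniformSpace)).
    - apply filterlim_C; [exact _| |].
      + simpl. change (is_lim (fun u => - exp (- u))%R p_infty (-0)%R).
        apply (is_lim_opp (fun u => exp (- u)) p_infty 0).
        apply (is_lim_comp exp (fun u => - u)%R p_infty 0 m_infty); [apply is_lim_exp_m | | exists 0%R; intros; discriminate].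
        apply (is_lim_opp (fun u => u) p_infty p_infty), is_lim_id.
      + simpl. apply (filterlim_const (F := _) (0%R : R_UniformSpace)). }
  pose proof (is_euler_integral 1 ltac:(simpl; lra)) as H1.
  rewrite (is_Cint_unique _ _ _ ends_half_line _ _ _ _ (fun _ _ => eq_refl) H1 H).
  rewrite <- RtoC_minus. f_equal. ring.
Qed.

Lemma Gamma_fact (n : nat) : Gamma (1 + RtoC (INR n)) = RtoC (INR (fact n)).
Proof.
  induction n as [|n IH].
  - simpl INR. replace (1 + RtoC 0) with (RtoC 1) by ring. apply Gamma_1.
  - replace (1 + RtoC (INR (S n))) with ((1 + RtoC (INR n)) + 1) by (rewrite S_INR, RtoC_plus; ring).
    rewrite Gamma_succ, IH by (unfold Re; simpl; pose proof (pos_INR n); lra).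
    rewrite fact_simpl, mult_INR, S_INR, RtoC_mult, RtoC_plus. ring.
Qed.

Lemma Gamma_neq_0_shift (z : C) (n : nat) : (0 < Re z)%R -> Gamma z <> 0 -> Gamma (z + RtoC (INR n)) <> 0.
Proof.
  intros Hz Nz. induction n as [|n IH].
  - simpl INR. replace (z + RtoC 0) with z by ring. exact Nz.
  - assert (Hn : (0 < Re (z + RtoC (INR n)))%R) by (rewrite Re_plus; simpl; pose proof (pos_INR n); lra).
    replace (z + RtoC (INR (S n))) with ((z + RtoC (INR n)) + 1) by (rewrite S_INR, RtoC_plus; ring).
    rewrite Gamma_succ by exact Hn. apply Cmult_neq_0; [apply Re_pos_neq_0, Hn | exact IH].
Qed.

Lemma is_RInt_gen_Re P Fa Fb (E : interval_ends P Fa Fb) (f : R -> C) (l : C) :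
  is_Cint f Fa Fb l -> is_RInt_gen (fun t => Re (f t)) Fa Fb (Re l).
Proof.
  intros H Q HQ.
  pose proof (ends_left _ _ _ E) as FA. pose proof (ends_right _ _ _ E) as FB.
  assert (K : filterlim Re (@locally C_UniformSpace l) (locally (Re l))).
  { apply (filterlim_Re (@locally C_UniformSpace l) (fun z => z)), filterlim_id. }
  pose proof (H _ (K Q HQ)) as G. unfold filtermapi in *.
  refine (filter_imp _ _ _ G). intros uv [y [Hy Qy]]. exists (Re y). split; [|exact Qy].
  exact (is_RInt_fct_extend_fst (U := R_NormedModule) (V := R_NormedModule) f _ _ y Hy).
Qed.

(** The part of Euler's integral over [K, K + 1] already gives
    Gamma(x + 1) >= K^x e^(-(K+1)). As K is arbitrary, Gamma(lambda n + 1)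
    outgrows every geometric sequence when lambda > 0. *)
Lemma Cmod_Gamma_ge (x K : R) : (0 <= x)%R -> (0 < K)%R ->
  (exp (x * ln K - (K + 1)) <= Cmod (Gamma (RtoC (x + 1))))%R.
Proof.
  intros Hx HK. assert (Hz : (0 < Re (RtoC (x + 1)))%R) by (simpl; lra).
  rewrite Gamma_euler by exact Hz.
  pose proof (is_RInt_gen_Re _ _ _ ends_half_line _ _ (is_euler_integral _ Hz)) as I.
  assert (G : forall u, Re (gamma_kernel (RtoC (x + 1)) u) = exp (x * ln u - u)).
  { intros u. unfold gamma_kernel. replace (_ + _) with (RtoC (x * ln u - u)).
    - rewrite Cexp_RtoC. reflexivity.
    - rewrite ?RtoC_minus, RtoC_mult, RtoC_plus, RtoC_opp. ring. }
  assert (C : forall t, (0 < t)%R -> continuous (fun u => Re (gamma_kernel (RtoC (x + 1)) u)) t)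
    by (intros t Ht; apply continuous_Re, continuous_gamma_kernel, Ht).
  eapply Rle_trans; [|apply re_le_Cmod]. eapply Rle_trans; [|apply Rle_abs].
  eapply Rle_trans; [|apply (RInt_le_is_RInt_gen _ _ _ ends_half_line _ _ K (K + 1) C)]; auto; try lra.
  - replace (exp (x * ln K - (K + 1))) with (RInt (fun _ => exp (x * ln K - (K + 1))) K (K + 1)).
    2:{ rewrite RInt_const. unfold scal; simpl; unfold mult; simpl. ring. }
    apply RInt_le; [lra | apply ex_RInt_const | |].
    + apply (ex_RInt_interval (V := R_CompleteNormedModule) _ _ _ ends_half_line); auto; lra.
    + intros t Ht. rewrite G. apply exp_monotone.
      assert (x * ln K <= x * ln t)%R by (apply Rmult_le_compat_l; [lra | apply ln_le; lra]). lra.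
  - intros t Ht. rewrite G. left; apply exp_pos.
Qed.

Lemma mittag_leffler_majorant (lambda r : R) : (0 <= lambda)%R -> (0 <= r)%R -> (lambda = 0%R -> (r < 1)%R) ->
  exists M : nat -> R, ex_series M /\
    forall z, (Cmod z <= r)%R -> forall n, (Cmod (mittag_leffler_term lambda z n) <= M n)%R.
Proof.
  intros Hl Hr H0.
  assert (B : exists A q, (0 <= A)%R /\ (0 <= q)%R /\ (r * q < 1)%R /\
    forall n, Gamma (RtoC (lambda * INR n + 1)) <> 0 /\ (/ Cmod (Gamma (RtoC (lambda * INR n + 1))) <= A * q ^ n)%R).
  { destruct (Req_dec lambda 0) as [E|E].
    - exists 1%R, 1%R. specialize (H0 E). repeat split; try lra;
      replace (lambda * INR n + 1)%R with 1%R by (rewrite E; ring); rewrite Gamma_1.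
      + intros K; apply RtoC_inj in K; lra.
      + rewrite Cmod_1, pow1. lra.
    (* With this K one has K^lambda = r + 1, which exceeds r. *)
    - set (c := ln (r + 1)). set (K := exp (c / lambda)).
      assert (c0 : (exp (- c) = / (r + 1))%R) by (unfold c; rewrite exp_Ropp, exp_ln by lra; reflexivity).
      exists (exp (K + 1)), (exp (- c)).
      pose proof (exp_pos (K + 1)). pose proof (exp_pos (- c)). repeat split; try lra.
      + rewrite c0. apply Rlt_div_l; lra.
      + pose proof (pos_INR n) as Pn.
        pose proof (Cmod_Gamma_ge (lambda * INR n) K ltac:(nra) (exp_pos _)) as G.
        intros Z. rewrite Z, Cmod_0 in G. pose proof (exp_pos (lambda * INR n * ln K - (K + 1))). lra.
      + pose proof (pos_INR n) as Pn.
        pose proof (Cmod_Gamma_ge (lambda * INR n) K ltac:(nra) (exp_pos _)) as G.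
        apply Rle_trans with (/ exp (lambda * INR n * ln K - (K + 1)))%R.
        * apply Rinv_le_contravar; [apply exp_pos | exact G].
        * rewrite <- exp_Ropp. unfold K at 1. rewrite ln_exp.
          replace (- (lambda * INR n * (c / lambda) - (K + 1)))%R with ((K + 1) + INR n * (- c))%R by (field; auto).
          rewrite exp_plus. right. f_equal. clear. induction n as [|n IH].
          { simpl. rewrite Rmult_0_l, exp_0. reflexivity. }
          { rewrite S_INR. replace ((INR n + 1) * - c)%R with (INR n * - c + - c)%R by ring.
            rewrite exp_plus, IH. simpl. ring. } }
  destruct B as [A [q [HA [Hq [Hrq HB]]]]].
  exists (fun n => A * (r * q) ^ n)%R. split.
  - apply (ex_series_scal_l A (fun n => (r * q) ^ n)%R). exists (/ (1 - r * q))%R. apply is_series_geom.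
    rewrite Rabs_pos_eq; [exact Hrq | nra].
  - intros z Hz n. unfold mittag_leffler_term. destruct (HB n) as [N B].
    unfold Cdiv. rewrite Cmod_mult, Cmod_inv by exact N.
    rewrite Rpow_mult_distr. replace (A * (r ^ n * q ^ n))%R with (r ^ n * (A * q ^ n))%R by ring.
    apply Rmult_le_compat; auto.
    + apply Cmod_ge_0.
    + left. apply Rinv_0_lt_compat, Cmod_gt_0, N.
    + clear - Hz. induction n as [|n IH]; simpl; [rewrite Cmod_1; lra|].
      rewrite Cmod_mult. apply Rmult_le_compat; auto; apply Cmod_ge_0.
Qed.

(** * The beta integral along a complex segment *)

Lemma continuous_bounded_unit (f : R -> C) :
  (forall x, (0 <= x <= 1)%R -> ccont f x) -> exists M, forall x, (0 <= x <= 1)%R -> (Cmod (f x) <= M)%R.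
Proof.
  intros Hf. destruct (continuity_ab_maj (fun x => Cmod (f x)) 0 1) as [x [Hx _]]; [lra| |].
  - intros c Hc. apply continuity_pt_filterlim, (continuous_Cmod f c), Hf, Hc.
  - exists (Cmod (f x)). exact Hx.
Qed.

(** Cutting [0, 1] into N pieces bounds the total increment by K / N. This
    stands for a vanishing derivative and avoids differentiating under an
    improper integral. *)
Lemma constant_of_quadratic_increments (F : R -> C) (K : R) :
  (forall s t, (0 <= s)%R -> (s <= t)%R -> (t <= 1)%R -> (Cmod (F t - F s) <= K * (t - s) ^ 2)%R) ->
  F 1%R = F 0%R.
Proof.
  intros HF.
  assert (K0 : (0 <= K)%R).
  { pose proof (HF 0%R 1%R) as H. pose proof (Cmod_ge_0 (F 1%R - F 0%R)). 
    specialize (H ltac:(lra) ltac:(lra) ltac:(lra)). lra. }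
  assert (B : forall n, (Cmod (F 1%R - F 0%R) <= K / (INR n + 1))%R).
  { intros n. set (h := (/ (INR n + 1))%R).
    assert (Pn : (0 < INR n + 1)%R) by (pose proof (pos_INR n); lra).
    assert (Hh : (0 < h)%R) by (apply Rinv_0_lt_compat, Pn).
    assert (G : forall k, (k <= S n)%nat -> (Cmod (F (INR k * h)%R - F 0%R) <= INR k * (K * h ^ 2))%R).
    { induction k as [|k IH]; intros Hk.
      - simpl. rewrite !Rmult_0_l. replace (F 0%R - F 0%R) with (RtoC 0) by ring. rewrite Cmod_0. lra.
      - replace (F (INR (S k) * h)%R - F 0%R) with ((F (INR (S k) * h)%R - F (INR k * h)%R) + (F (INR k * h)%R - F 0%R)) by ring.
        eapply Rle_trans; [apply Cmod_triangle|].
        assert (Q : (INR (S k) * h <= 1)%R).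
        { apply le_INR in Hk. rewrite (S_INR n) in Hk. unfold h.
          apply Rle_trans with ((INR n + 1) * / (INR n + 1))%R; [apply Rmult_le_compat_r; [left; exact Hh | exact Hk]|].
          right; field; lra. }
        rewrite S_INR in *.
        pose proof (HF (INR k * h)%R ((INR k + 1) * h)%R) as A.
        pose proof (pos_INR k) as Pk.
        specialize (A ltac:(nra) ltac:(nra) Q). specialize (IH ltac:(lia)).
        replace ((INR k + 1) * h - INR k * h)%R with h in A by ring. lra. }
    specialize (G (S n) (le_n _)). rewrite S_INR in G.
    replace ((INR n + 1) * h)%R with 1%R in G by (unfold h; field; lra).
    replace ((INR n + 1) * (K * h ^ 2))%R with (K / (INR n + 1))%R in G by (unfold h; field; lra). exact G. }
  assert (Z : (Cmod (F 1%R - F 0%R) <= 0)%R).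
  { apply le_epsilon. intros eps He. rewrite Rplus_0_l.
    destruct (nfloor_ex (K / eps)) as [n [_ Hn]].
    { apply Rdiv_le_0_compat; lra. }
    eapply Rle_trans; [apply (B n)|]. apply Rle_div_l; [pose proof (pos_INR n); lra|].
    assert (K < (INR n + 1) * eps)%R by (apply Rlt_div_l; lra). lra. }
  assert (E : F 1%R - F 0%R = 0) by (apply Cmod_eq_0; pose proof (Cmod_ge_0 (F 1%R - F 0%R)); lra).
  replace (F 1%R) with ((F 1%R - F 0%R) + F 0%R) by ring. rewrite E. ring.
Qed.

(** The value is found by shrinking the segment; here d + k s is D(s), l is the
    branch of its logarithm and m = k / D the derivative of l. Write
      phi(sigma, s) = D(sigma)^alpha D(sigma s)^(-(alpha+beta)),
      q = alpha m(sigma) - (alpha + beta) s m(sigma s),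
    so that q phi is the sigma-derivative of phi. Uniformly in s, phi is
    approximated by its tangent up to a quadratic error (T below), and the
    integral of the tangent direction is 0 (Z below) since it is the
    s-derivative of s^alpha (1-s)^beta m(sigma) phi(sigma, s). The latter is the
    identity D(s sigma) ((1-s) alpha - s beta)
    - (alpha+beta) s (1-s) sigma k = alpha D(s sigma) - (alpha+beta) s D(sigma),
    valid because D is affine. *)
Lemma beta_integral_along_segment (alpha beta d k : C) (l m : R -> C) :
  (0 < Re alpha)%R -> (0 < Re beta)%R ->
  (forall x, (0 <= x <= 1)%R -> d + k * RtoC x <> 0) ->
  (forall x, (0 <= x <= 1)%R -> m x = k / (d + k * RtoC x)) ->
  (forall x, (0 <= x <= 1)%R -> ccont m x) ->
  (forall x, (0 <= x <= 1)%R -> cderive l x (m x)) ->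
  is_Cint (fun s => beta_kernel alpha beta s * Cexp (- (alpha + beta) * l s)) (at_right 0) (at_left 1)
    (Cexp (- alpha * l 1%R) * Cexp (- beta * l 0%R) * beta_integral alpha beta).
Proof.
  intros Ha Hb HD Hm Cm Dl.
  pose proof (ends_left _ _ _ ends_unit) as FA. pose proof (ends_right _ _ _ ends_unit) as FB.
  assert (Cl : forall x, (0 <= x <= 1)%R -> ccont l x).
  { intros x Hx. apply (ex_derive_continuous (K := R_AbsRing) (V := C_R_NormedModule)). exists (m x). apply Dl, Hx. }
  destruct (continuous_bounded_unit l Cl) as [Ml HMl].
  destruct (continuous_bounded_unit m Cm) as [Mm HMm].
  assert (Ml0 : (0 <= Ml)%R) by (eapply Rle_trans; [apply Cmod_ge_0 | apply (HMl 0%R); lra]).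
  assert (Mm0 : (0 <= Mm)%R) by (eapply Rle_trans; [apply Cmod_ge_0 | apply (HMm 0%R); lra]).
  set (A := (Cmod alpha + Cmod (alpha + beta))%R).
  assert (A0 : (0 <= A)%R) by (unfold A; pose proof (Cmod_ge_0 alpha); pose proof (Cmod_ge_0 (alpha + beta)); lra).
  set (phi := fun sg s : R => Cexp (alpha * l sg - (alpha + beta) * l (sg * s)%R)).
  set (q := fun sg s : R => alpha * m sg - (alpha + beta) * (RtoC s * m (sg * s)%R)).
  assert (In : forall sg s, (0 <= sg <= 1)%R -> (0 < s < 1)%R -> (0 <= sg * s <= 1)%R) by (intros; nra).
  assert (Lin : forall u v B, (Cmod u <= B)%R -> (Cmod v <= B)%R -> (Cmod (alpha * u - (alpha + beta) * v) <= A * B)%R).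
  { intros u v B Hu Hv. unfold Cminus. eapply Rle_trans; [apply Cmod_triangle|]. rewrite Cmod_opp, !Cmod_mult. unfold A.
    rewrite Rmult_plus_distr_r. apply Rplus_le_compat; apply Rmult_le_compat_l; auto; apply Cmod_ge_0. }
  set (Ph := exp (A * Ml)). assert (Ph0 : (0 < Ph)%R) by apply exp_pos.
  assert (Bphi : forall sg s, (0 <= sg <= 1)%R -> (0 < s < 1)%R -> (Cmod (phi sg s) <= Ph)%R).
  { intros sg s Hs Hx. unfold phi. rewrite Cmod_Cexp. apply exp_monotone.
    eapply Rle_trans; [apply Rle_abs|]. eapply Rle_trans; [apply re_le_Cmod|]. apply Lin; apply HMl; auto. }
  assert (Bq : forall sg s, (0 <= sg <= 1)%R -> (0 < s < 1)%R -> (Cmod (q sg s) <= A * Mm)%R).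
  { intros sg s Hs Hx. unfold q. apply Lin; [apply HMm; auto|]. rewrite Cmod_mult, Cmod_R, Rabs_pos_eq by lra.
    pose proof (HMm _ (In sg s Hs Hx)). pose proof (Cmod_ge_0 (m (sg * s)%R)). nra. }
  assert (Lm : forall x y, (0 <= x <= 1)%R -> (0 <= y <= 1)%R -> (Cmod (m x - m y) <= Mm ^ 2 * Rabs (x - y))%R).
  { intros x y Hx Hy. replace (m x - m y) with (m x * m y * RtoC (y - x)).
    - rewrite !Cmod_mult, Cmod_R, (Rabs_minus_sym y x). apply Rmult_le_compat_r; [apply Rabs_pos|].
      simpl. rewrite Rmult_1_r. apply Rmult_le_compat; try apply Cmod_ge_0; auto.
    - rewrite !Hm, RtoC_minus by auto. field. split; apply HD; auto. }
  assert (Lq : forall sg tu s, (0 <= sg <= 1)%R -> (0 <= tu <= 1)%R -> (0 < s < 1)%R ->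
     (Cmod (q sg s - q tu s) <= A * (Mm ^ 2 * Rabs (sg - tu)))%R).
  { intros sg tu s H1 H2 Hs. unfold q.
    replace (_ - _) with (alpha * (m sg - m tu) - (alpha + beta) * (RtoC s * (m (sg * s)%R - m (tu * s)%R))) by ring.
    apply Lin; [apply Lm; auto|]. rewrite Cmod_mult, Cmod_R, Rabs_pos_eq by lra.
    pose proof (Lm _ _ (In sg s H1 Hs) (In tu s H2 Hs)) as L.
    replace (sg * s - tu * s)%R with ((sg - tu) * s)%R in L by ring.
    rewrite Rabs_mult, (Rabs_pos_eq s) in L by lra.
    pose proof (Cmod_ge_0 (m (sg * s)%R - m (tu * s)%R)). pose proof (Rabs_pos (sg - tu)).
    assert (0 <= Mm ^ 2 * Rabs (sg - tu))%R by (apply Rmult_le_pos; [apply pow2_ge_0 | auto]).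
    nra. }
  assert (Dphi : forall sg s, (0 <= sg <= 1)%R -> (0 < s < 1)%R -> cderive (fun x => phi x s) sg (q sg s * phi sg s)).
  { intros sg s Hsg Hs. unfold phi.
    apply (is_derive_Cexp (fun x => alpha * l x - (alpha + beta) * l (x * s)%R)).
    assert (D2 : cderive (fun x => l (x * s)%R) sg (RtoC s * m (sg * s)%R)).
    { rewrite <- scal_R_Cmult.
      apply (is_derive_comp (V := C_R_NormedModule) l (fun x => (x * s)%R)); [apply Dl; auto|].
      auto_derive; auto; ring. }
    unfold q. unfold Cminus.
    replace (- ((alpha + beta) * (RtoC s * m (sg * s)%R))) with (- (alpha + beta) * (RtoC s * m (sg * s)%R)) by ring.
    apply is_derive_ext with (f := fun x => alpha * l x + - (alpha + beta) * l (x * s)%R); [intros x; match goal with |- ?a = ?b => change (@eq C a b) end; ring|].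
    apply is_derive_Cplus; apply is_derive_Cscal; auto. }
  assert (Cphi : forall sg s, (0 <= sg <= 1)%R -> (0 < s < 1)%R -> ccont (fun x => phi x s) sg).
  { intros sg s H1 H2. apply (ex_derive_continuous (K := R_AbsRing) (V := C_R_NormedModule)). eexists; apply Dphi; auto. }
  assert (Clin : forall f sg s, (0 <= sg <= 1)%R -> (0 < s < 1)%R -> (forall x, (0 <= x <= 1)%R -> ccont f x) ->
     ccont (fun x => f (x * s)%R) sg /\ ccont (fun x => f (sg * x)%R) s).
  { intros f sg s H1 H2 Hf. split.
    - apply (continuous_comp (fun x => (x * s)%R) f).
      + eapply is_derive_continuous_R. auto_derive; auto.
      + apply Hf; auto.
    - apply (continuous_comp (fun x => (sg * x)%R) f).
      + eapply is_derive_continuous_R. auto_derive; auto.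
      + apply Hf; auto. }
  assert (Cphis : forall sg s, (0 <= sg <= 1)%R -> (0 < s < 1)%R -> ccont (phi sg) s).
  { intros sg s H1 H2. unfold phi. apply continuous_Cexp, continuous_Cplus; [apply continuous_Cconst|].
    apply continuous_Copp, continuous_Cmult; [apply continuous_Cconst|]. apply Clin; auto. }
  assert (Cqs : forall sg s, (0 <= sg <= 1)%R -> (0 < s < 1)%R -> ccont (q sg) s).
  { intros sg s H1 H2. unfold q. apply continuous_Cplus; [apply continuous_Cconst|].
    apply continuous_Copp, continuous_Cmult; [apply continuous_Cconst|]. apply continuous_Cmult.
    - apply continuous_RtoC, continuous_id.
    - apply Clin; auto. }
  assert (Cq : forall sg s, (0 <= sg <= 1)%R -> (0 < s < 1)%R -> ccont (fun x => q x s) sg).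
  { intros sg s H1 H2. unfold q. apply continuous_Cplus; [apply continuous_Cmult; [apply continuous_Cconst | auto]|].
    apply continuous_Copp, continuous_Cmult; [apply continuous_Cconst|]. apply continuous_Cmult; [apply continuous_Cconst|].
    apply Clin; auto. }
  set (K := (A * Mm * (A * Mm * Ph) + A * Mm ^ 2 * Ph)%R).
  assert (T : forall tu sg s, (0 <= tu)%R -> (tu <= sg)%R -> (sg <= 1)%R -> (0 < s < 1)%R ->
     (Cmod (phi sg s - phi tu s - RtoC (sg - tu) * (q tu s * phi tu s)) <= K * (sg - tu) ^ 2)%R).
  { intros tu sg s H0 H1 H2 Hs.
    assert (Lphi : forall x, (tu <= x <= sg)%R -> (Cmod (phi x s - phi tu s) <= (x - tu) * (A * Mm * Ph))%R).
    { intros x Hx. apply (mean_value_C (fun x => phi x s) (fun x => q x s * phi x s)); [lra| | |]; intros y Hy.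
      - apply Dphi; lra.
      - apply continuous_Cmult; [apply Cq | apply Cphi]; lra.
      - rewrite Cmod_mult. apply Rmult_le_compat; try apply Cmod_ge_0; [apply Bq | apply Bphi]; lra. }
    set (c := q tu s * phi tu s).
    replace (phi sg s - phi tu s - RtoC (sg - tu) * c) with
      ((phi sg s + - c * RtoC sg) - (phi tu s + - c * RtoC tu)) by (rewrite RtoC_minus; ring).
    replace (K * (sg - tu) ^ 2)%R with ((sg - tu) * (K * (sg - tu)))%R by ring.
    apply (mean_value_C (fun x => phi x s + - c * RtoC x) (fun x => q x s * phi x s + - c * 1)); [lra| | |]; intros y Hy.
    - apply is_derive_Cplus; [apply Dphi; lra|]. apply is_derive_Cscal, is_derive_RtoC, (is_derive_id (K := R_AbsRing)).
    - apply continuous_Cplus; [|apply continuous_Cconst]. apply continuous_Cmult; [apply Cq | apply Cphi]; lra.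
    - unfold c. replace (_ + _) with (q y s * (phi y s - phi tu s) + (q y s - q tu s) * phi tu s) by ring.
      eapply Rle_trans; [apply Cmod_triangle|]. rewrite !Cmod_mult.
      pose proof (Bq y s ltac:(lra) Hs) as B1. pose proof (Bphi tu s ltac:(lra) Hs) as B2.
      pose proof (Lphi y ltac:(lra)) as B3. pose proof (Lq y tu s ltac:(lra) ltac:(lra) Hs) as B4.
      rewrite Rabs_pos_eq in B4 by lra.
      apply Rle_trans with ((A * Mm) * ((y - tu) * (A * Mm * Ph)) + A * (Mm ^ 2 * (y - tu)) * Ph)%R.
      + apply Rplus_le_compat; apply Rmult_le_compat; auto; apply Cmod_ge_0.
      + replace (_ + _)%R with (K * (y - tu))%R by (unfold K; ring). apply Rmult_le_compat_l; [|lra].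
        unfold K. assert (0 <= A * Mm)%R by (apply Rmult_le_pos; auto). assert (0 <= A * Mm ^ 2)%R by (apply Rmult_le_pos; [auto | apply pow2_ge_0]).
        apply Rplus_le_le_0_compat; repeat apply Rmult_le_pos; auto; lra. }
  destruct (beta_kernel_majorant alpha beta Ha Hb) as [g [lg [Cg [Ig Hg]]]].
  assert (Cw : forall t, (0 < t < 1)%R -> ccont (beta_kernel alpha beta) t) by (intros; apply continuous_beta_kernel; auto).
  set (F := fun sg => @RInt_gen C_R_CompleteNormedModule (fun s => beta_kernel alpha beta s * phi sg s) (at_right 0) (at_left 1)).
  assert (HF : forall sg, (0 <= sg <= 1)%R -> is_Cint (fun s => beta_kernel alpha beta s * phi sg s) (at_right 0) (at_left 1) (F sg)).
  { intros sg Hsg. apply (is_Cint_RInt_gen _ _ _ ends_unit).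
    apply (is_Cint_dominated _ _ _ ends_unit _ (fun s => Ph * g s)%R (Ph * lg)%R).
    - intros s Hs. apply continuous_Cmult; auto.
    - intros s Hs. apply (continuous_mult (K := R_AbsRing)); [apply continuous_const | auto].
    - intros s Hs. rewrite Cmod_mult, Rmult_comm. apply Rmult_le_compat; auto; apply Cmod_ge_0.
    - apply (is_RInt_gen_scal (V := R_NormedModule)); auto. }
  assert (Z : forall sg, (0 <= sg <= 1)%R -> is_Cint (fun s => beta_kernel alpha beta s * (q sg s * phi sg s)) (at_right 0) (at_left 1) (0 - 0)).
  { intros sg Hsg.
    destruct (filterlim_beta_primitive alpha beta (fun s => m sg * phi sg s) (Mm * Ph) Ha Hb) as [L0 L1].
    { intros s Hs. rewrite Cmod_mult. apply Rmult_le_compat; try apply Cmod_ge_0; auto. }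
    refine (is_RInt_gen_primitive (V := C_R_CompleteNormedModule) _ _ _ ends_unit 
      (fun s => beta_primitive alpha beta s * (m sg * phi sg s)) _ (RtoC 0) (RtoC 0) _ _ L0 L1).
    - intros s Hs.
      assert (D2 : cderive (phi sg) s ((- (alpha + beta) * (RtoC sg * m (sg * s)%R)) * phi sg s)).
      { unfold phi. apply (is_derive_Cexp (fun x => alpha * l sg - (alpha + beta) * l (sg * x)%R)).
        apply is_derive_ext with (f := fun x => alpha * l sg + - (alpha + beta) * l (sg * x)%R); [intros x; match goal with |- ?a = ?b => change (@eq C a b) end; ring|].
        replace (- (alpha + beta) * (RtoC sg * m (sg * s)%R)) with (0 + - (alpha + beta) * (RtoC sg * m (sg * s)%R)) by ring.
        apply is_derive_Cplus; [apply is_derive_Cconst|]. apply is_derive_Cscal. rewrite <- scal_R_Cmult.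
        apply (is_derive_comp (V := C_R_NormedModule) l (fun x => (sg * x)%R)); [apply Dl; auto|].
        auto_derive; auto; ring. }
      pose proof (is_derive_Cmult _ _ _ _ _ (is_derive_beta_primitive alpha beta s Hs) (is_derive_Cscal _ _ _ (m sg) D2)) as D.
      match type of D with @is_derive _ _ _ _ ?e => replace (beta_kernel alpha beta s * (q sg s * phi sg s)) with e; [exact D|] end.
      rewrite beta_primitive_kernel by exact Hs. unfold q. rewrite !Hm by auto.
      pose proof (HD sg Hsg) as N1. pose proof (HD _ (In sg s Hsg Hs)) as N2.
      rewrite !RtoC_mult, RtoC_minus in *. field. auto.
    - intros s Hs. apply continuous_Cmult; auto. apply continuous_Cmult; auto. }
  assert (E : F 1%R = F 0%R).
  { apply (constant_of_quadratic_increments F (K * lg)). intros tu sg H0 H1 H2.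
    replace (F sg - F tu) with (F sg - F tu - RtoC (sg - tu) * (0 - 0)) by ring.
    replace (K * lg * (sg - tu) ^ 2)%R with (K * (sg - tu) ^ 2 * lg)%R by ring.
    apply (Cmod_is_Cint_le _ _ _ ends_unit
      (fun s => beta_kernel alpha beta s * phi sg s - beta_kernel alpha beta s * phi tu s -
         RtoC (sg - tu) * (beta_kernel alpha beta s * (q tu s * phi tu s)))
      (fun s => K * (sg - tu) ^ 2 * g s)%R).
    - intros s Hs. replace (_ - _) with (beta_kernel alpha beta s * (phi sg s - phi tu s - RtoC (sg - tu) * (q tu s * phi tu s))) by ring.
      rewrite Cmod_mult, Rmult_comm. apply Rmult_le_compat; try apply Cmod_ge_0; auto.
    - apply (is_Cint_minus (at_right 0) (at_left 1)); [apply (is_Cint_minus (at_right 0) (at_left 1))|apply (is_Cint_scal (at_right 0) (at_left 1))].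
      + apply HF; lra.
      + apply HF; lra.
      + apply Z; lra.
    - apply (is_RInt_gen_scal (V := R_NormedModule)); auto. }
  assert (F0 : F 0%R = Cexp (- beta * l 0%R) * beta_integral alpha beta).
  { refine (is_Cint_unique _ _ _ ends_unit _ _ _ _ _ (HF 0%R _) (is_Cint_scal (at_right 0) (at_left 1) _ _ _ (is_beta_integral alpha beta Ha Hb))); [|lra].
    intros s Hs. simpl. unfold phi. rewrite Rmult_0_l, Cmult_comm. f_equal. f_equal. ring. }
  rewrite <- Cmult_assoc, <- F0, <- E.
  apply (is_Cint_ext _ _ _ ends_unit (fun s => Cexp (- alpha * l 1%R) * (beta_kernel alpha beta s * phi 1%R s))).
  - intros s Hs. unfold phi. rewrite Rmult_1_l.
    replace (- (alpha + beta) * l s) with (- alpha * l 1%R + (alpha * l 1%R - (alpha + beta) * l s)) by ring.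
    rewrite Cexp_plus. ring.
  - apply (is_Cint_scal (at_right 0) (at_left 1)). apply HF. lra.
Qed.

(** * Continuous branches of the logarithm are smooth *)

Definition clamp (x : R) : R := Rmax 0 (Rmin 1 x).

Lemma clamp_range x : (0 <= clamp x <= 1)%R.
Proof. unfold clamp, Rmax, Rmin. destruct (Rle_dec 1 x); destruct (Rle_dec 0 _); lra. Qed.

Lemma clamp_id x : (0 <= x <= 1)%R -> clamp x = x.
Proof. intros H. unfold clamp. rewrite Rmin_right, Rmax_right; lra. Qed.

Lemma continuous_clamp x : continuous clamp x.
Proof.
  apply filterlim_locally. intros eps. exists eps. intros y By.
  unfold_balls.
  eapply Rle_lt_trans; [|exact By].
  unfold clamp, Rmax, Rmin. destruct (Rle_dec 1 x), (Rle_dec 1 y); repeat destruct (Rle_dec 0 _);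
  apply Rabs_le; unfold Rabs; destruct (Rcase_abs (y + - x)); lra.
Qed.

Lemma continuous_on_clamp (f : R -> C) :
  @continuous_on R_UniformSpace C_UniformSpace (fun s => (0 <= s <= 1)%R) f ->
  forall x, ccont (fun t => f (clamp t)) x.
Proof.
  intros Hf x. apply (filterlim_comp _ _ _ clamp f _ (within (fun s => (0 <= s <= 1)%R) (locally (clamp x)))).
  - intros Q HQ. unfold filtermap, within in *. refine (filter_imp (F := locally x) (fun t => (0 <= clamp t <= 1)%R -> Q (clamp t)) _ _ (continuous_clamp x _ HQ)).
    intros t Ht. apply Ht, clamp_range.
  - apply Hf, clamp_range.
Qed.

(** The imaginary part takes values in 2 pi Z and starts at 0; if it did not
    stay there, it would cross an absolute value in (0, 1], where the cosine is
    below 1. *)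
Lemma Cexp_eq_1_continuous (h : R -> C) :
  (forall x, ccont h x) -> (forall x, Cexp (h x) = 1) -> h 0%R = 0 -> forall x, h x = 0.
Proof.
  intros Ch Eh H0 x.
  assert (Er : forall t, Re (h t) = 0%R).
  { intros t. apply exp_inv. rewrite <- Cmod_Cexp, Eh, Cmod_1, exp_0. reflexivity. }
  assert (Ei : forall t, cos (Im (h t)) = 1%R).
  { intros t. pose proof (f_equal Re (Eh t)) as A. unfold Cexp in A. rewrite Er, exp_0 in A.
    simpl in A. rewrite <- A. ring. }
  apply C_ext; [rewrite Er; reflexivity|]. simpl.
  destruct (Req_dec (Im (h x)) 0) as [E|N]; [exact E|exfalso].
  set (G := fun t => Rabs (Im (h t))).
  assert (CG : Ranalysis1.continuity G).
  { intros t. apply continuity_pt_filterlim. apply (continuous_comp (fun t => Im (h t)) Rabs).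
    - apply continuous_Im, Ch.
    - apply (continuous_Rabs). }
  assert (G0 : G 0%R = 0%R) by (unfold G; rewrite H0; simpl; apply Rabs_R0).
  assert (Gx : (0 < G x)%R) by (apply Rabs_pos_lt, N).
  destruct (IVT_gen G 0 x (Rmin (G x) 1) CG) as [c [_ Hc]].
  { rewrite G0, Rmin_left, Rmax_right by lra. split; [apply Rmin_glb; lra | apply Rmin_l]. }
  assert (V : (0 < G c <= 1)%R) by (rewrite Hc; split; [apply Rmin_glb_lt; lra | apply Rmin_r]).
  assert (cos (G c) < cos 0)%R by (pose proof PI2_1; pose proof PI_RGT_0; apply cos_decreasing_1; lra).
  assert (CA : cos (G c) = 1%R).
  { unfold G, Rabs. destruct (Rcase_abs (Im (h c))); [rewrite cos_neg|]; apply Ei. }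
  rewrite CA, cos_0 in H. lra.
Qed.

(** The candidate is the primitive l of k / (d + k s) with the same value at 0.
    The product e^(-l) (d + k s) has derivative 0, so l is a branch of the
    logarithm, and ell - l satisfies [Cexp_eq_1_continuous]. Extending the
    integrand constantly outside [0, 1] makes l differentiable at the endpoints
    as well. *)
Lemma log_branch_smooth (d k : C) (ell : R -> C) :
  @continuous_on R_UniformSpace C_UniformSpace (fun s => (0 <= s <= 1)%R) ell ->
  (forall s, (0 <= s <= 1)%R -> Cexp (ell s) = d + k * RtoC s) ->
  exists l m : R -> C,
    (forall x, (0 <= x <= 1)%R -> l x = ell x) /\
    (forall x, (0 <= x <= 1)%R -> m x = k / (d + k * RtoC x)) /\
    (forall x, (0 <= x <= 1)%R -> ccont m x) /\
    (forall x, (0 <= x <= 1)%R -> cderive l x (m x)).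
Proof.
  intros Cell Eell.
  assert (ND : forall x, (0 <= x <= 1)%R -> d + k * RtoC x <> 0).
  { intros x Hx. rewrite <- Eell by exact Hx. apply Cexp_neq_0. }
  set (m := fun x => k / (d + k * RtoC (clamp x))).
  assert (Cm : forall x, ccont m x).
  { intros x. apply continuous_Cmult; [apply continuous_Cconst|]. apply continuous_Cinv; [|apply ND, clamp_range].
    apply continuous_Cplus; [apply continuous_Cconst|]. apply continuous_Cmult; [apply continuous_Cconst|].
    apply continuous_RtoC, continuous_clamp. }
  set (l := fun x => ell 0%R + @RInt C_R_CompleteNormedModule m 0 x).
  assert (Dl : forall x, cderive l x (m x)).
  { intros x. unfold l. replace (m x) with (0 + m x) by ring.
    apply is_derive_Cplus; [apply is_derive_Cconst|].
    apply (is_derive_RInt (V := C_R_NormedModule) m _ 0 x).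
    - apply filter_forall. intros y. apply (RInt_correct (V := C_R_CompleteNormedModule)).
      apply (ex_RInt_continuous (V := C_R_CompleteNormedModule)). intros z _. apply Cm.
    - apply Cm. }
  assert (Cl : forall x, ccont l x).
  { intros x. apply (ex_derive_continuous (K := R_AbsRing) (V := C_R_NormedModule)). exists (m x). apply Dl. }
  assert (l0 : l 0%R = ell 0%R).
  { unfold l. rewrite RInt_point. apply Cplus_0_r. }
  assert (El : forall x, (0 <= x <= 1)%R -> Cexp (l x) = d + k * RtoC x).
  { intros x Hx. set (g := fun t => Cexp (- (1) * l t) * (d + k * RtoC t)).
    assert (Z : (Cmod (g x - g 0%R) <= (x - 0) * 0)%R).
    { apply (mean_value_C g (fun t => (- (1) * m t) * Cexp (- (1) * l t) * (d + k * RtoC t) + Cexp (- (1) * l t) * (0 + k * 1))); [lra| | |]; intros y Hy.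
      - apply is_derive_Cmult; [apply (is_derive_Cexp (fun t => - (1) * l t)), is_derive_Cscal, Dl|].
        apply is_derive_Cplus; [apply is_derive_Cconst|]. apply is_derive_Cscal, is_derive_RtoC, (is_derive_id (K := R_AbsRing)).
      - assert (CE : ccont (fun t => Cexp (- (1) * l t)) y) by (apply continuous_Cexp, continuous_Cmult; [apply continuous_Cconst | apply Cl]).
        apply continuous_Cplus; [|apply continuous_Cmult; [exact CE | apply continuous_Cconst]].
        apply continuous_Cmult; [apply continuous_Cmult; [|exact CE]|].
        + apply continuous_Cmult; [apply continuous_Cconst | apply Cm].
        + apply continuous_Cplus; [apply continuous_Cconst|]. apply continuous_Cmult; [apply continuous_Cconst|].
          apply continuous_RtoC, continuous_id.
      - unfold m. rewrite clamp_id by lra.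
        replace (_ + _) with (RtoC 0); [rewrite Cmod_0; lra|]. field. apply ND; lra. }
    rewrite Rmult_0_r in Z.
    assert (E : g x - g 0%R = 0) by (apply Cmod_eq_0; pose proof (Cmod_ge_0 (g x - g 0%R)); lra).
    assert (G0 : g 0%R = 1).
    { unfold g. rewrite l0, <- Eell, <- Cexp_plus by lra.
      transitivity (Cexp 0); [f_equal; ring | apply Cexp_0]. }
    assert (Gx : g x = 1) by (replace (g x) with (g x - g 0%R + g 0%R) by ring; rewrite E, G0; ring).
    unfold g in Gx. transitivity (Cexp (l x) * (Cexp (- (1) * l x) * (d + k * RtoC x))).
    - rewrite Gx. ring.
    - rewrite Cmult_assoc, <- Cexp_plus. replace (l x + - (1) * l x) with (RtoC 0) by ring. rewrite Cexp_0. ring. }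
  exists l, m. split; [|split; [|split]]; auto.
  - intros x Hx.
    assert (H : ell (clamp x) - l (clamp x) = 0).
    { apply (Cexp_eq_1_continuous (fun t => ell (clamp t) - l (clamp t))).
      - intros t. apply continuous_Cplus; [apply continuous_on_clamp, Cell|]. apply continuous_Copp.
        apply (continuous_comp clamp l); [apply continuous_clamp | apply Cl].
      - intros t. pose proof (clamp_range t) as Ht. unfold Cminus. rewrite Cexp_plus, Cexp_opp, Eell, El by exact Ht.
        apply Cinv_r, ND, Ht.
      - rewrite clamp_id, l0 by lra. ring. }
    rewrite clamp_id in H by exact Hx. replace (ell x) with (ell x - l x + l x) by ring. rewrite H. ring.
  - intros x Hx. unfold m. rewrite clamp_id by exact Hx. reflexivity.
Qed.

(** * Complex series *)

Lemma Cseries_unique (u : nat -> C) (s : C) :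
  @is_series C_AbsRing C_NormedModule u s -> Cseries u = s.
Proof.
  intros Hs. unfold Cseries. apply (iota_unique (V := C_CompleteNormedModule)); [|exact Hs].
  intros y Hy. exact (filterlim_locally_unique _ _ _ Hy Hs).
Qed.

Lemma Cseries_correct (u : nat -> C) :
  ex_Cseries u -> @is_series C_AbsRing C_NormedModule u (Cseries u).
Proof. intros [s Hs]. rewrite (Cseries_unique u s Hs). exact Hs. Qed.

Lemma is_series_Cscal (c : C) (u : nat -> C) (s : C) :
  @is_series C_AbsRing C_NormedModule u s ->
  @is_series C_AbsRing C_NormedModule (fun n => c * u n) (c * s).
Proof. exact (is_series_scal (K := C_AbsRing) (V := C_NormedModule) c u s). Qed.

Lemma is_series_Cext (u v : nat -> C) (s : C) : (forall n, u n = v n) ->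
  @is_series C_AbsRing C_NormedModule u s -> @is_series C_AbsRing C_NormedModule v s.
Proof. exact (is_series_ext (V := C_NormedModule) u v s). Qed.

Lemma Cinv_0 : / RtoC 0 = 0.
Proof. apply C_ext; simpl; unfold Rdiv; ring. Qed.

(** * Transport to the interval with endpoints a and b *)

Lemma inside_proper (a b x : R) : a <> b -> x = a \/ x = b -> ProperFilter (inside a b x).
Proof.
  intros Hab Hx. constructor; [|apply within_filter, locally_filter].
  intros Q [d Hd]. pose proof (cond_pos d) as Pd.
  assert (Hlt : (Rmin a b < Rmax a b)%R) by (unfold Rmin, Rmax; destruct (Rle_dec a b); lra).
  set (h := Rmin (d / 2) ((Rmax a b - Rmin a b) / 2)).
  assert (Ph : (0 < h)%R) by (apply Rmin_glb_lt; lra).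
  pose proof (Rmin_l (d / 2) ((Rmax a b - Rmin a b) / 2)) as H1.
  pose proof (Rmin_r (d / 2) ((Rmax a b - Rmin a b) / 2)) as H2. fold h in H1, H2.
  assert (Hx' : x = Rmin a b \/ x = Rmax a b)
    by (unfold Rmin, Rmax; destruct (Rle_dec a b); tauto).
  destruct Hx' as [E|E]; [exists (x + h)%R | exists (x - h)%R]; apply Hd; try lra;
  unfold_ball;
  apply Rabs_lt_between; lra.
Qed.

Lemma inside_self (a b x : R) : inside a b x (fun t => (Rmin a b < t < Rmax a b)%R).
Proof. exists (mkposreal 1 Rlt_0_1). auto. Qed.

Lemma inside_unit (a b t : R) : a <> b -> (Rmin a b < t < Rmax a b)%R -> (0 < (t - a) / (b - a) < 1)%R.
Proof.
  intros Hab. unfold Rmin, Rmax. destruct (Rle_dec a b); intros Ht.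
  - split; [apply Rdiv_lt_0_compat | apply Rlt_div_l]; lra.
  - replace ((t - a) / (b - a))%R with ((a - t) / (a - b))%R by (field; lra).
    split; [apply Rdiv_lt_0_compat | apply Rlt_div_l]; lra.
Qed.

Lemma filterlim_inside_left (a b : R) : a <> b ->
  filterlim (fun t => ((t - a) / (b - a))%R) (inside a b a) (at_right 0).
Proof.
  intros Hab Q HQ. unfold filtermap, inside, at_right, within in *.
  assert (C : continuous (fun t => ((t - a) / (b - a))%R) a).
  { eapply is_derive_continuous_R. auto_derive; [lra | reflexivity]. }
  unfold continuous in C. replace ((a - a) / (b - a))%R with 0%R in C by (field; lra).
  refine (filter_imp (F := locally a) (fun t => (0 < (t - a) / (b - a))%R -> Q ((t - a) / (b - a))%R) _ _ (C _ HQ)).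
  intros t Ht Hi. apply Ht. apply (inside_unit a b t Hab Hi).
Qed.

Lemma filterlim_inside_right (a b : R) : a <> b ->
  filterlim (fun t => ((t - a) / (b - a))%R) (inside a b b) (at_left 1).
Proof.
  intros Hab Q HQ. unfold filtermap, inside, at_left, within in *.
  assert (C : continuous (fun t => ((t - a) / (b - a))%R) b).
  { eapply is_derive_continuous_R. auto_derive; [lra | reflexivity]. }
  unfold continuous in C. replace ((b - a) / (b - a))%R with 1%R in C by (field; lra).
  refine (filter_imp (F := locally b) (fun t => ((t - a) / (b - a) < 1)%R -> Q ((t - a) / (b - a))%R) _ _ (C _ HQ)).
  intros t Ht Hi. apply Ht. apply (inside_unit a b t Hab Hi).
Qed.

Lemma is_Cint_inside (a b : R) (f : R -> C) (v : C) : a <> b ->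
  (forall s, (0 < s < 1)%R -> ccont f s) ->
  is_Cint f (at_right 0) (at_left 1) v ->
  is_Cint (fun t => / RtoC (b - a) * f ((t - a) / (b - a))%R) (inside a b a) (inside a b b) v.
Proof.
  intros hab Cf Hf.
  pose proof (inside_proper a b a hab (or_introl eq_refl)) as FA.
  pose proof (inside_proper a b b hab (or_intror eq_refl)) as FB.
  refine (is_RInt_gen_ext (V := C_R_NormedModule) (fun t => @scal _ C_R_ModuleSpace (/ (b - a))%R (f ((t - a) / (b - a))%R)) _ _ _ _).
  { apply filter_forall. intros ab t _. rewrite scal_R_Cmult, RtoC_inv by lra. reflexivity. }
  apply (is_RInt_gen_subst (V := C_R_CompleteNormedModule) (fun t => (Rmin a b < t < Rmax a b)%R)
    (inside a b a) (inside a b b) (at_right 0) (at_left 1)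
    f (fun t => ((t - a) / (b - a))%R) (fun _ => / (b - a))%R).
  - intros y1 y2 y3 H1 H2 H3. pose proof (Rmin_glb_lt y1 y2 _ (proj1 H1) (proj1 H2)).
    pose proof (Rmax_lub_lt y1 y2 _ (proj2 H1) (proj2 H2)). lra.
  - apply inside_self.
  - apply inside_self.
  - intros t Ht. apply Cf, (inside_unit a b t hab Ht).
  - intros t Ht. auto_derive; [lra | field; lra].
  - intros t Ht. apply continuous_const.
  - apply filterlim_inside_left, hab.
  - apply filterlim_inside_right, hab.
  - exact Hf.
Qed.

Lemma is_Cint_inside_ext (a b : R) (f g : R -> C) (v : C) : a <> b ->
  (forall t, (Rmin a b < t < Rmax a b)%R -> f t = g t) ->
  is_Cint f (inside a b a) (inside a b b) v -> is_Cint g (inside a b a) (inside a b b) v.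
Proof.
  intros hab Hfg Hf.
  pose proof (inside_proper a b a hab (or_introl eq_refl)) as FA.
  pose proof (inside_proper a b b hab (or_intror eq_refl)) as FB.
  refine (is_RInt_gen_ext (V := C_R_NormedModule) f g _ _ Hf).
  apply (Filter_prod _ _ _ _ _ (inside_self a b a) (inside_self a b b)).
  intros y1 y2 H1 H2 t Ht. apply Hfg. simpl in Ht.
  pose proof (Rmin_glb_lt y1 y2 _ (proj1 H1) (proj1 H2)).
  pose proof (Rmax_lub_lt y1 y2 _ (proj2 H1) (proj2 H2)). lra.
Qed.

Lemma weight_unit (a b : R) (alpha beta L : C) (ell : R -> C) (t : R) :
  let s := ((t - a) / (b - a))%R in
  a <> b -> Cexp L = RtoC (b - a) ->
  weight a b alpha beta L ell t =
  / RtoC (b - a) * (/ RtoC (b - a) * (beta_kernel alpha beta s * Cexp (- (alpha + beta) * ell s))).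
Proof.
  intros s hab EL. unfold weight, Rpowc, beta_kernel. fold s.
  rewrite <- EL, <- Cexp_opp, <- !Cexp_plus. f_equal. ring.
Qed.

Lemma parameter_closed (a b t : R) : a <> b -> (Rmin a b <= t <= Rmax a b)%R -> (0 <= (t - a) / (b - a) <= 1)%R.
Proof.
  intros hab. unfold Rmin, Rmax. destruct (Rle_dec a b); intros Ht.
  - split; [apply Rdiv_le_0_compat | apply Rle_div_l]; lra.
  - replace ((t - a) / (b - a))%R with ((a - t) / (a - b))%R by (field; lra).
    split; [apply Rdiv_le_0_compat | apply Rle_div_l]; lra.
Qed.

Lemma xi_unit (a b : R) (mu nu : C) (t : R) :
  let s := ((t - a) / (b - a))%R in
  let D := 1 + mu + (nu - mu) * RtoC s in
  a <> b -> D <> 0 -> xi a b mu nu t = RtoC (s * (1 - s)) / D ^ 2.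
Proof.
  intros s D hab ND.
  assert (Nba : RtoC (b - a) <> 0) by (intros E; apply RtoC_inj in E; lra).
  assert (Et : t = (a + (b - a) * s)%R) by (unfold s; field; lra).
  unfold xi. replace (chi a b mu nu t) with (RtoC (b - a) * D).
  - rewrite Et at 1 2.
    replace ((a + (b - a) * s - a) * (b - (a + (b - a) * s)))%R with ((b - a) * (b - a) * (s * (1 - s)))%R by ring.
    rewrite RtoC_mult, (RtoC_mult (b - a)). simpl. field. auto.
  - unfold chi, D. rewrite Et.
    replace (a + (b - a) * s - a)%R with ((b - a) * s)%R by ring.
    replace (b - (a + (b - a) * s))%R with ((b - a) * (1 - s))%R by ring.
    rewrite !RtoC_mult, (RtoC_minus 1 s). ring.
Qed.

(** * The Wright series as a series of beta integrals *)

Lemma beta_kernel_shift (alpha beta : C) (n : nat) (s : R) : (0 < s < 1)%R ->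
  beta_kernel (alpha + RtoC (INR n)) (beta + RtoC (INR n)) s = beta_kernel alpha beta s * RtoC (s * (1 - s)) ^ n.
Proof.
  intros Hs. rewrite RtoC_mult, <- (Cexp_ln s), <- (Cexp_ln (1 - s)), <- Cexp_plus, <- Cexp_mult_INR by lra.
  unfold beta_kernel. rewrite <- Cexp_plus. f_equal. ring.
Qed.

Lemma Gamma_real_neq_0 (x : R) : (0 <= x)%R -> Gamma (RtoC (x + 1)) <> 0.
Proof.
  intros Hx E. pose proof (Cmod_Gamma_ge x 1 Hx Rlt_0_1) as G. rewrite E, Cmod_0 in G.
  pose proof (exp_pos (x * ln 1 - (1 + 1))). lra.
Qed.

Lemma beta_integral_Gamma (alpha beta : C) (n : nat) :
  (0 < Re alpha)%R -> (0 < Re beta)%R -> Gamma (alpha + beta) <> 0 ->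
  beta_integral (alpha + RtoC (INR n)) (beta + RtoC (INR n)) =
  Gamma (alpha + RtoC (INR n)) * Gamma (beta + RtoC (INR n)) / Gamma (alpha + beta + RtoC (2 * INR n)).
Proof.
  intros Ha Hb N.
  assert (Ha' : (0 < Re (alpha + RtoC (INR n)))%R) by (rewrite Re_plus; simpl; pose proof (pos_INR n); lra).
  assert (Hb' : (0 < Re (beta + RtoC (INR n)))%R) by (rewrite Re_plus; simpl; pose proof (pos_INR n); lra).
  assert (Hab : (0 < Re (alpha + beta))%R) by (rewrite Re_plus; lra).
  pose proof (Gamma_neq_0_shift (alpha + beta) (2 * n) Hab N) as N2.
  rewrite mult_INR in N2. change (INR 2) with 2%R in N2.
  assert (Habn : (0 < Re (alpha + beta + RtoC (2 * INR n)))%R) by (rewrite !Re_plus; simpl; pose proof (pos_INR n); lra).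
  pose proof (beta_integral_euler _ _ Ha' Hb') as E.
  rewrite (Gamma_euler _ Ha'), (Gamma_euler _ Hb'), <- E, (Gamma_euler _ Habn).
  rewrite (Gamma_euler _ Habn) in N2.
  replace (alpha + RtoC (INR n) + (beta + RtoC (INR n))) with (alpha + beta + RtoC (2 * INR n)) by (rewrite RtoC_mult; ring).
  field. exact N2.
Qed.

(** The factor Gamma(1 + n) in the numerator cancels n!, and the quotient of
    the remaining Gamma values is B(alpha + n, beta + n) / B(alpha, beta). If
    Gamma(alpha), Gamma(beta) or Gamma(alpha + beta) is 0, both sides are 0 by
    the convention / 0 = 0; otherwise Gamma(alpha + beta + 2 n) is not 0 either,
    by Gamma(z + 1) = z Gamma(z). *)
Lemma wright_hat_term_beta_integral (alpha beta mu nu p l0 l1 : C) (lambda : R) (n : nat) :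
  (0 < Re alpha)%R -> (0 < Re beta)%R -> (0 <= lambda)%R ->
  Cexp l0 = mu + 1 -> Cexp l1 = nu + 1 ->
  wright_hat_term [(alpha, 1%R); (beta, 1%R); (RtoC 1, 1%R)] [(alpha + beta, 2%R); (RtoC 1, lambda)]
    (p / ((nu + 1) * (mu + 1))) n =
  1 / Beta alpha beta / (Cexp (- alpha * l1) * Cexp (- beta * l0)) *
  (p ^ n / Gamma (RtoC (lambda * INR n + 1)) *
   (Cexp (- (alpha + RtoC (INR n)) * l1) * Cexp (- (beta + RtoC (INR n)) * l0) *
    beta_integral (alpha + RtoC (INR n)) (beta + RtoC (INR n)))).
Proof.
  intros Ha Hb Hlambda E0 E1.
  unfold wright_hat_term, gamma_ratio_prod. simpl fold_right. simpl fst. simpl snd.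
  destruct (Ceq_dec (Gamma alpha) 0) as [Y|N1].
  { unfold Beta, Cdiv. rewrite Y, ?Cmult_0_l, ?Cinv_0. ring. }
  destruct (Ceq_dec (Gamma beta) 0) as [Y|N2].
  { unfold Beta, Cdiv. rewrite Y, ?Cmult_0_r, ?Cmult_0_l, ?Cinv_0. ring. }
  destruct (Ceq_dec (Gamma (alpha + beta)) 0) as [Y|N3].
  { unfold Beta, Cdiv. rewrite Y, ?Cinv_0, ?Cmult_0_r, ?Cmult_0_l, ?Cinv_0. ring. }
  rewrite beta_integral_Gamma by auto.
  assert (Hab : (0 < Re (alpha + beta))%R) by (rewrite Re_plus; lra).
  pose proof (Gamma_neq_0_shift (alpha + beta) (2 * n) Hab N3) as N4.
  rewrite mult_INR in N4. change (INR 2) with 2%R in N4.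
  pose proof (Gamma_real_neq_0 (lambda * INR n) ltac:(pose proof (pos_INR n); nra)) as N5.
  rewrite !Rmult_1_l, Gamma_fact, Gamma_1. rewrite <- RtoC_plus, (Rplus_comm 1).
  assert (N6 : RtoC (INR (fact n)) <> 0) by (intros Y; apply RtoC_inj in Y; apply (INR_fact_neq_0 n Y)).
  assert (S : forall c l, Cexp (- (c + RtoC (INR n)) * l) = Cexp (- c * l) * / Cexp l ^ n).
  { intros c l. rewrite <- Cexp_mult_INR, <- Cexp_opp, <- Cexp_plus. f_equal. ring. }
  rewrite !S, E0, E1. unfold Cdiv, Beta.
  assert (M1 : nu + 1 <> 0) by (rewrite <- E1; apply Cexp_neq_0).
  assert (M0 : mu + 1 <> 0) by (rewrite <- E0; apply Cexp_neq_0).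
  rewrite Cpow_mult_l, Cpow_inv, Cpow_mult_l by (apply Cmult_neq_0; auto).
  pose proof (Cpow_nz _ n M1). pose proof (Cpow_nz _ n M0).
  pose proof (Cexp_neq_0 (- alpha * l1)). pose proof (Cexp_neq_0 (- beta * l0)).
  field. repeat split; auto.
Qed.

Theorem theorem4 (a b : R) (alpha beta mu nu p : C) (lambda : R)
    (L : C) (ell : R -> C)
    (hab : a <> b)
    (halpha : (0 < Re alpha)%R) (hbeta : (0 < Re beta)%R)
    (hlambda : (0 <= lambda)%R)
    (hchi : forall t : R, (Rmin a b <= t <= Rmax a b)%R ->
       chi a b mu nu t <> 0)
    (hxi : lambda = 0%R -> forall t : R, (Rmin a b <= t <= Rmax a b)%R ->
       (Cmod (p * xi a b mu nu t) < 1)%R)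
    (hL : log_length a b L)
    (hell : log_branch mu nu ell) :
  let integrand := fun t : R =>
    weight a b alpha beta L ell t
    * mittag_leffler lambda (p * xi a b mu nu t) in
  let num := [(alpha, 1%R); (beta, 1%R); (RtoC 1, 1%R)] in
  let den := [(alpha + beta, 2%R); (RtoC 1, lambda)] in
  let z := p / ((nu + 1) * (mu + 1)) in
  (forall t : R, (Rmin a b <= t <= Rmax a b)%R ->
     ex_Cseries (mittag_leffler_term lambda (p * xi a b mu nu t)))
  /\ ex_CRInt integrand a b
  /\ ex_Cseries (wright_hat_term num den z)
  /\ 1 / Beta alpha beta * CRInt integrand a b
     = Cexp (- alpha * ell 1%R) * Cexp (- beta * ell 0%R) / RtoC (b - a)
       * wright_hat num den z.
Proof.
  intros integrand num den z.
  destruct hell as [Cell Eell]. destruct hL as [EL _].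
  set (D := fun s => 1 + mu + (nu - mu) * RtoC s).
  assert (ED : forall s, (0 <= s <= 1)%R -> Cexp (ell s) = D s).
  { intros s Hs. rewrite Eell by exact Hs. unfold D. rewrite RtoC_minus. ring. }
  assert (ND : forall s, (0 <= s <= 1)%R -> D s <> 0)
    by (intros s Hs; rewrite <- ED by exact Hs; apply Cexp_neq_0).
  assert (CD : forall s, ccont D s).
  { intros s. apply continuous_Cplus; [apply continuous_Cconst|].
    apply continuous_Cmult; [apply continuous_Cconst|]. apply continuous_RtoC, continuous_id. }
  destruct (log_branch_smooth (1 + mu) (nu - mu) ell Cell ED) as [l [m [Hl [Hm [Cm Dl]]]]].
  set (x := fun s => RtoC (s * (1 - s)) / D s ^ 2).
  assert (Cx : forall s, (0 <= s <= 1)%R -> ccont x s).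
  { intros s Hs. apply continuous_Cmult.
    - apply continuous_RtoC. eapply is_derive_continuous_R. auto_derive; auto.
    - apply (continuous_Cinv (fun s => D s ^ 2)); [apply continuous_Cpow, CD | apply Cpow_nz, ND, Hs]. }
  assert (Exi : forall t, (Rmin a b <= t <= Rmax a b)%R -> xi a b mu nu t = x ((t - a) / (b - a))%R).
  { intros t Ht. apply xi_unit; [exact hab | apply ND, parameter_closed; auto]. }
  destruct (continuity_ab_maj (fun s => Cmod (p * x s)) 0 1) as [s0 [Hmax Hs0]]; [lra| |].
  { intros c Hc. apply continuity_pt_filterlim, (continuous_Cmod (fun s => p * x s) c), continuous_Cmult;
    [apply continuous_Cconst | apply Cx, Hc]. }
  set (r := Cmod (p * x s0)) in *.
  (* For lambda = 0 the geometric series converges uniformly because the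
     maximum r is attained on the closed interval, where it is below 1. *)
  assert (Hr : lambda = 0%R -> (r < 1)%R).
  { intros E. unfold r.
    assert (Ht : (Rmin a b <= a + (b - a) * s0 <= Rmax a b)%R)
      by (unfold Rmin, Rmax; destruct (Rle_dec a b); nra).
    pose proof (hxi E _ Ht) as H. rewrite Exi in H by exact Ht.
    replace ((a + (b - a) * s0 - a) / (b - a))%R with s0 in H by (field; lra). exact H. }
  destruct (mittag_leffler_majorant lambda r hlambda (Cmod_ge_0 _) Hr) as [M [HM BM]].
  assert (ExM : forall y, (Cmod y <= r)%R -> ex_Cseries (mittag_leffler_term lambda y)).
  { intros y Hy. apply (ex_series_le (V := C_CompleteNormedModule) _ M); [|exact HM]. intros n. apply (BM y Hy n). }
  split.
  { intros t Ht. apply ExM. rewrite Exi by exact Ht. apply Hmax, parameter_closed; auto. }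
  set (w := fun s => beta_kernel alpha beta s * Cexp (- (alpha + beta) * l s)).
  set (I := fun n : nat => p ^ n / Gamma (RtoC (lambda * INR n + 1)) *
     (Cexp (- (alpha + RtoC (INR n)) * ell 1%R) * Cexp (- (beta + RtoC (INR n)) * ell 0%R) *
       beta_integral (alpha + RtoC (INR n)) (beta + RtoC (INR n)))).
  pose proof (ends_left _ _ _ ends_unit) as FA0. pose proof (ends_right _ _ _ ends_unit) as FB0.
  (* Multiplying the weight by the n-th power of s (1 - s) / D(s)^2 only
     shifts alpha and beta by n. *)
  assert (HI : forall n, is_Cint (fun s => w s * mittag_leffler_term lambda (p * x s) n) (at_right 0) (at_left 1) (I n)).
  { intros n.
    assert (Ha' : (0 < Re (alpha + RtoC (INR n)))%R) by (rewrite Re_plus; simpl; pose proof (pos_INR n); lra).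
    assert (Hb' : (0 < Re (beta + RtoC (INR n)))%R) by (rewrite Re_plus; simpl; pose proof (pos_INR n); lra).
    pose proof (beta_integral_along_segment _ _ (1 + mu) (nu - mu) l m Ha' Hb' ND Hm Cm Dl) as H.
    rewrite (Hl 0%R), (Hl 1%R) in H by lra.
    refine (is_Cint_ext _ _ _ ends_unit _ _ _ _ (is_Cint_scal (at_right 0) (at_left 1) (p ^ n / Gamma (RtoC (lambda * INR n + 1))) _ _ H)).
    intros s Hs. simpl. rewrite beta_kernel_shift by exact Hs. unfold w, mittag_leffler_term, x.
    pose proof (ND s ltac:(lra)) as N.
    unfold Cdiv. rewrite !Cpow_mult_l, Cpow_inv by (apply Cpow_nz, N).
    rewrite <- (ED s), <- Hl by lra.
    replace (- (alpha + RtoC (INR n) + (beta + RtoC (INR n))) * l s)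
      with (- (alpha + beta) * l s + - (RtoC (INR n) * (2 * l s))) by ring.
    replace ((Cexp (l s) ^ 2)) with (Cexp (2 * l s)).
    2:{ replace (2 * l s) with (l s + l s) by ring. rewrite Cexp_plus. simpl. ring. }
    rewrite <- Cexp_mult_INR, Cexp_plus, Cexp_opp. ring. }
  destruct (beta_kernel_majorant alpha beta halpha hbeta) as [g [lg [Cg [Ig Hg]]]].
  assert (Ce : forall s, (0 <= s <= 1)%R -> ccont (fun s => Cexp (- (alpha + beta) * l s)) s).
  { intros s Hs. apply continuous_Cexp, continuous_Cmult; [apply continuous_Cconst|].
    apply (ex_derive_continuous (K := R_AbsRing) (V := C_R_NormedModule)). exists (m s). apply Dl, Hs. }
  assert (Cw : forall s, (0 < s < 1)%R -> ccont w s).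
  { intros s Hs. apply continuous_Cmult; [apply continuous_beta_kernel, Hs | apply Ce; lra]. }
  assert (Ct : forall n s, (0 < s < 1)%R -> ccont (fun s => mittag_leffler_term lambda (p * x s) n) s).
  { intros n s Hs. unfold mittag_leffler_term. apply continuous_Cmult; [|apply continuous_Cconst].
    apply (continuous_Cpow (fun s => p * x s)), continuous_Cmult; [apply continuous_Cconst | apply Cx; lra]. }
  assert (Bt : forall n s, (0 < s < 1)%R -> (Cmod (mittag_leffler_term lambda (p * x s) n) <= M n)%R).
  { intros n s Hs. apply BM, Hmax. lra. }
  assert (St : forall s, (0 < s < 1)%R ->
    @is_series C_AbsRing C_NormedModule (mittag_leffler_term lambda (p * x s)) (mittag_leffler lambda (p * x s))).
  { intros s Hs. apply Cseries_correct, ExM, Hmax. lra. }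
  destruct (continuous_bounded_unit _ Ce) as [W HW].
  destruct (is_Cint_series _ _ _ ends_unit w (fun s => W * g s)%R (W * lg)%R
     (fun n s => mittag_leffler_term lambda (p * x s) n) (fun s => mittag_leffler lambda (p * x s)) M I) as [v [Hv HIv]]; auto.
  { intros s Hs. apply (continuous_mult (K := R_AbsRing)); [apply continuous_const | apply Cg, Hs]. }
  { intros s Hs. unfold w. rewrite Cmod_mult, Rmult_comm.
    apply Rmult_le_compat; try apply Cmod_ge_0; [apply HW; lra | apply Hg, Hs]. }
  { apply (is_RInt_gen_scal (V := R_NormedModule)), Ig. }
  pose proof (inside_proper a b a hab (or_introl eq_refl)) as FA.
  pose proof (inside_proper a b b hab (or_intror eq_refl)) as FB.
  assert (Hint : is_Cint integrand (inside a b a) (inside a b b) (/ RtoC (b - a) * v)).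
  { refine (is_Cint_inside_ext a b _ _ _ hab _ (is_Cint_scal (inside a b a) (inside a b b) (/ RtoC (b - a)) _ _
      (is_Cint_inside a b _ _ hab _ Hv))).
    - intros t Ht. pose proof (inside_unit a b t hab Ht) as Hs.
      unfold integrand. rewrite Exi by lra. rewrite (weight_unit a b alpha beta L ell t hab EL).
      unfold w. rewrite Hl by lra. ring.
    - intros s Hs. apply continuous_Cmult; [apply Cw, Hs|].
      apply (continuous_series (fun s => (0 < s < 1)%R) (fun n s => mittag_leffler_term lambda (p * x s) n) _ M); auto.
      apply (ends_open _ _ _ ends_unit), Hs. }
  assert (EI : CRInt integrand a b = / RtoC (b - a) * v).
  { assert (PA : ProperFilter' (inside a b a)) by (apply Proper_StrongProper; assumption).
    assert (PB : ProperFilter' (inside a b b)) by (apply Proper_StrongProper; assumption).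
    apply (is_RInt_gen_unique (V := C_R_CompleteNormedModule)), Hint. }
  split; [exists (/ RtoC (b - a) * v); exact Hint|].
  set (E := Cexp (- alpha * ell 1%R) * Cexp (- beta * ell 0%R)).
  assert (NE : E <> 0) by (apply Cmult_neq_0; apply Cexp_neq_0).
  assert (HWr : @is_series C_AbsRing C_NormedModule (wright_hat_term num den z) (1 / Beta alpha beta / E * v)).
  { apply (is_series_Cext (fun k => 1 / Beta alpha beta / E * I k)); [|apply is_series_Cscal, HIv].
    intros k. symmetry. apply wright_hat_term_beta_integral; auto; rewrite ED by lra; unfold D; ring. }
  split; [eexists; exact HWr|].
  unfold wright_hat. rewrite (Cseries_unique _ _ HWr), EI. fold E. unfold Cdiv.
  transitivity (E * / E * (1 * / Beta alpha beta * (/ RtoC (b - a) * v))); [|ring].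
  rewrite Cinv_r by exact NE. ring.
Qed.
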